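(* Let $r\ge 1$, let $f\in\mathbb{C}[z_1,z_1^{-1},\ldots,z_r,z_r^{-1}]$, and let $\varepsilon>0$. Suppose $\mathbf{a}=(a_1,\ldots,a_r)\in\mathbb{R}^r\setminus\mathcal{A}_f$ is a point whose (Euclidean) distance from $\mathcal{A}_f$ is at least $\varepsilon$. Let $d=d(\Delta(f))$ and $c=\max\{c_i(f)\mid 1\le i\le r\}$. Let $n$ be a positive integer. 1. If $n\varepsilon\ \ge\ (r-1)\log n+\log\big((r+3)2^{r+1}c\big)$, then $\tilde f_n\{\mathbf{a}\}$ is lopsided. 2. If $n\varepsilon\ \ge\ (r^2-1)\log n+\log\big(\tfrac{16}{3}cd\big)$, then $\tilde f_n\{\mathbf{a}\}$ is superlopsided; in fact it is $(d\,n^{r^2-r})$-superlopsided.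
   Context: $\mathrm{Log}:(\mathbb{C}^* )^r\to\mathbb{R}^r$ is $\mathrm{Log}(z_1,\ldots,z_r)=(\log|z_1|,\ldots,\log|z_r|)$. The amoeba $\mathcal{A}_f$ is $\mathrm{Log}(Z_f)$, where $Z_f\subset(\mathbb{C}^* )^r$ is the zero locus of $f$. For a Laurent polynomial $g$ written as a sum of monomials $g=m_1+\cdots+m_s$ (nonzero coefficients, distinct exponent vectors) and $\mathbf{a}\in\mathbb{R}^r$, $g\{\mathbf{a}\}$ is the list of positive real numbers $\{|m_1(\mathbf{z})|,\ldots,|m_s(\mathbf{z})|\}$ for any $\mathbf{z}\in\mathrm{Log}^{-1}(\mathbf{a})$ (independent of the choice). A list of positive numbers is lopsided if one of the numbers is greater than the sum of all the others (an empty sum is $0$; the empty list is not lopsided). A list is $d'$-superlopsided if it has an entry $b_i$ with $b_i>d'b_j$ for all $j\neq i$; a list of $s+1$ positive numbers is superlopsided if it is $s$-superlopsided. For a positive integer $n$, $\tilde f_n(\mathbf{z})=\prod_{k_1=0}^{n-1}\cdots\prod_{k_r=0}^{n-1}f(e^{2\pi i k_1/n}z_1,\ldots,e^{2\pi i k_r/n}z_r)$. $\Delta(f)\subset\mathbb{R}^r$ is the Newton polytope of $f$ (convex hull of the exponent vectors of the monomials appearing in $f$). For a polytope $\Delta$, $d(\Delta)$ denotes any fixed upper bound for $\#(\mathbb{Z}^r\cap m\Delta)/m^r$ valid for all positive integers $m$. Also $c_i(f)=\max x_i(\Delta(f))-\min x_i(\Delta(f))$, where $x_i$ is the $i$-th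 coordinate function. Conventions: $\log 0=-\infty$, and the distance from a point to the empty set is $+\infty$. *)

(* Defs.v *)
From HB Require Import structures.
From mathcomp Require Import all_boot all_order all_algebra finmap complex.
From mathcomp Require Import all_classical all_reals all_analysis.
(* The notations of monalg clash with those of MathComp-Analysis. *)
From mathcomp.multinomials Require Import -(notations) monalg.

Set Implicit Arguments.
Unset Strict Implicit.
Unset Printing Implicit Defensive.

Import Order.TTheory GRing.Theory Num.Theory ComplexField.

Local Open Scope classical_set_scope.
Local Open Scope ring_scope.
Local Open Scope complex_scope.

(* Laurent polynomials in r variables: finitely supported functions from
   exponent vectors in Z^r to coefficients.  The product of monalg requires a
   monoid of exponents without nontrivial units, which excludes Z^r, so that
   only the additive structure is inherited and the convolution product is
   defined below.  [mcoeff u f] is the coefficient of z^u in f, [msupp f] is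
   the set of the exponents that appear in f, and [mkmalgU u a] is a * z^u. *)
Definition laurent (A : nzRingType) (r : nat) := malg 'rV[int]_r A.

HB.instance Definition _ (A : nzRingType) (r : nat) :=
  GRing.Zmodule.on (laurent A r).

HB.lock Definition lmul (A : comNzRingType) (r : nat) (f g : laurent A r) :
    laurent A r :=
  \sum_(u <- msupp f) \sum_(v <- msupp g)
    mkmalgU (u + v) (mcoeff u f * mcoeff v g).

Section LaurentRing.
Variables (A : comNzRingType) (r : nat).
Implicit Types (f g h : laurent A r) (u v : 'rV[int]_r) (a b : A).

Definition lone : laurent A r := mkmalgU 0 1.

Lemma lsumW (M : nmodType) (phi : 'rV[int]_r -> A -> M) f
    (D : {fset 'rV[int]_r}) :
  (forall u, phi u 0 = 0) -> (msupp f `<=` D)%fset ->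
  \sum_(u <- msupp f) phi u (mcoeff u f) = \sum_(u <- D) phi u (mcoeff u f).
Proof.
by move=> phi0 sfD; apply: big_fset_incl => // u _ /mcoeff_outdom ->.
Qed.

Lemma lsumD (M : nmodType) (phi : 'rV[int]_r -> A -> M) f g :
  (forall u, phi u 0 = 0) ->
  (forall u a b, phi u (a + b) = phi u a + phi u b) ->
  \sum_(u <- msupp (f + g)) phi u (mcoeff u (f + g)) =
  \sum_(u <- msupp f) phi u (mcoeff u f) +
  \sum_(u <- msupp g) phi u (mcoeff u g).
Proof.
move=> phi0 phiD; pose D := (msupp f `|` msupp g)%fset.
rewrite (@lsumW _ _ (f + g) D) //; last exact: msuppD_le.
rewrite (@lsumW _ _ f D) ?fsubsetUl // (@lsumW _ _ g D) ?fsubsetUr //.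
by rewrite -big_split /=; apply: eq_bigr => u _; rewrite mcoeffD phiD.
Qed.

Lemma lsumU (M : nmodType) (phi : 'rV[int]_r -> A -> M) u a :
  (forall v, phi v 0 = 0) ->
  \sum_(v <- msupp (mkmalgU u a)) phi v (mcoeff v (mkmalgU u a)) = phi u a.
Proof.
move=> phi0; rewrite (@lsumW _ _ _ [fset u]%fset) ?msuppU_le //.
by rewrite big_seq_fset1 mcoeffUU.
Qed.

Lemma laurent_ind (P : laurent A r -> Prop) :
  (forall u a, P (mkmalgU u a)) -> (forall f g, P f -> P g -> P (f + g)) ->
  forall f, P f.
Proof.
move=> PU PD f; rewrite [f]monalgE.
have P0 : P 0 by have := PU 0 0; rewrite monalgU0.
by elim/big_ind: _.
Qed.

Lemma lmulDl : left_distributive (@lmul A r) +%R.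
Proof.
move=> f g h; rewrite lmul.unlock.
apply: (@lsumD _ (fun u a => \sum_(v <- msupp h)
   mkmalgU (u + v) (a * mcoeff v h))) => [u|u a b].
  by rewrite big1 // => v _; rewrite mul0r monalgU0.
by rewrite -big_split; apply: eq_bigr => v _; rewrite mulrDl monalgUD.
Qed.

Lemma lmulC : commutative (@lmul A r).
Proof.
move=> f g; rewrite lmul.unlock exchange_big; apply: eq_bigr => u _ /=.
by apply: eq_bigr => v _; rewrite addrC mulrC.
Qed.

Lemma lmulUU u v a b :
  lmul (mkmalgU u a) (mkmalgU v b) = mkmalgU (u + v) (a * b).
Proof.
rewrite lmul.unlock (@lsumU _ (fun u a => \sum_(v' <- msupp (mkmalgU v b))
   mkmalgU (u + v') (a * mcoeff v' (mkmalgU v b)))).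
  apply: (@lsumU _ (fun v b => mkmalgU (u + v) (a * b))).
  by move=> w; rewrite mulr0 monalgU0.
by move=> w; rewrite big1 // => x _; rewrite mul0r monalgU0.
Qed.

Lemma lmulA : associative (@lmul A r).
Proof.
have lmulDr f g h : lmul f (g + h) = lmul f g + lmul f h.
  by rewrite !(lmulC f) lmulDl.
pose assoc f g h := lmul f (lmul g h) = lmul (lmul f g) h.
have assocDl f f' g h : assoc f g h -> assoc f' g h -> assoc (f + f') g h.
  by rewrite /assoc !lmulDl => -> ->.
have assocDm f g g' h : assoc f g h -> assoc f g' h -> assoc f (g + g') h.
  by rewrite /assoc !(lmulDl, lmulDr) => -> ->.
have assocDr f g h h' : assoc f g h -> assoc f g h' -> assoc f g (h + h').
  by rewrite /assoc !lmulDr => -> ->.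
move=> f g h; rewrite -/(assoc f g h).
elim/laurent_ind: f => [u a|f f']; last exact: assocDl.
elim/laurent_ind: g => [v b|g g']; last exact: assocDm.
elim/laurent_ind: h => [w c|h h']; last exact: assocDr.
by rewrite /assoc (lmulUU v w) (lmulUU u v) !lmulUU addrA mulrA.
Qed.

Lemma lmul1l : left_id lone (@lmul A r).
Proof.
move=> f; elim/laurent_ind: f => [u a|f g Hf Hg].
  by rewrite lmulUU add0r mul1r.
by rewrite lmulC lmulDl !(lmulC _ lone) Hf Hg.
Qed.

Lemma lone_neq0 : lone != 0.
Proof. by rewrite monalgU_eq0 oner_eq0. Qed.

HB.instance Definition _ := GRing.Zmodule_isComNzRing.Build (laurent A r)
  lmulA lmulC lmul1l lmulDl lone_neq0.

End LaurentRing.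

Section Evaluation.
Variables (F : fieldType) (r : nat).
Implicit Types (f g : laurent F r) (u v : 'rV[int]_r) (z w : 'rV[F]_r).

Definition torus z : Prop := forall i, z 0 i != 0.

Definition mono u z : F := \prod_(i < r) (z 0 i) ^ (u 0 i).

Definition leval f z : F := \sum_(u <- msupp f) mcoeff u f * mono u z.

(* The Laurent polynomial f(w_1 z_1, ..., w_r z_r). *)
Definition ltwist w f : laurent F r :=
  \sum_(u <- msupp f) mkmalgU u (mcoeff u f * mono u w).

Lemma monoD u v z : torus z -> mono (u + v) z = mono u z * mono v z.
Proof.
move=> zN0; rewrite /mono -big_split; apply: eq_bigr => i _ /=.
by rewrite mxE expfzDr.
Qed.

Lemma leval_mkmalgU u a z : leval (mkmalgU u a) z = a * mono u z.
Proof.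
by apply: (@lsumU F r _ (fun u a => a * mono u z)) => v; rewrite mul0r.
Qed.

Lemma levalD f g z : leval (f + g) z = leval f z + leval g z.
Proof.
apply: (@lsumD F r _ (fun u a => a * mono u z)) => [u|u a b].
  by rewrite mul0r.
by rewrite mulrDl.
Qed.

Lemma levalM f g z : torus z -> leval (f * g) z = leval f z * leval g z.
Proof.
move=> zN0.
elim/laurent_ind: f => [u a|f f' Hf Hf'].
  elim/laurent_ind: g => [v b|g g' Hg Hg'].
    by rewrite [_ * _]lmulUU !leval_mkmalgU monoD // mulrACA.
  by rewrite mulrDr !levalD Hg Hg' mulrDr.
by rewrite mulrDl !levalD Hf Hf' mulrDl.
Qed.

Lemma leval1 z : leval 1 z = 1.
Proof.
by rewrite leval_mkmalgU mul1r /mono big1 // => i _; rewrite mxE expr0z.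
Qed.

Lemma leval_ltwist w f z :
  leval (ltwist w f) z = leval f (\row_i (w 0 i * z 0 i)).
Proof.
have monoM u : mono u w * mono u z = mono u (\row_i (w 0 i * z 0 i)).
  by rewrite /mono -big_split; apply: eq_bigr => i _ /=; rewrite mxE expfzMl.
elim/laurent_ind: f => [u a|f g Hf Hg].
  rewrite /ltwist (@lsumU F r _ (fun u a => mkmalgU u (a * mono u w))).
    by rewrite !leval_mkmalgU -mulrA monoM.
  by move=> v; rewrite mul0r monalgU0.
rewrite /ltwist (@lsumD F r _ (fun u a => mkmalgU u (a * mono u w))).
- by rewrite !levalD -Hf -Hg.
- by move=> v; rewrite mul0r monalgU0.
- by move=> v a b; rewrite mulrDl monalgUD.
Qed.

End Evaluation.

Section Amoeba.
Variables (R : realType) (r : nat).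
Implicit Types (f g : laurent R[i] r) (z : 'rV[R[i]]_r) (a b : 'rV[R]_r).

Definition Log z : 'rV[R]_r := \row_i ln (Normc.normc (z 0 i)).

Definition zero_locus f : set 'rV[R[i]]_r := [set z | torus z /\ leval f z = 0].

Definition amoeba f : set 'rV[R]_r := Log @` zero_locus f.

(* The norm of the library on row vectors is the sup norm. *)
Definition eucl_dist a b : R := Num.sqrt (\sum_(i < r) (a 0 i - b 0 i) ^+ 2).

(* The infimum of the empty set is +oo. *)
Definition dist_to (B : set 'rV[R]_r) a : \bar R :=
  ereal_inf [set (eucl_dist a b)%:E | b in B].

(* The positive real point of the fiber of Log over a. *)
Definition exp_point a : 'rV[R[i]]_r := \row_i (expR (a 0 i))%:C.

Definition monomial_norms g z : seq R :=
  [seq Normc.normc (mcoeff u g * mono u z) | u <- msupp g].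

(* The list g{a}. *)
Definition norms_at g a : seq R := monomial_norms g (exp_point a).

Lemma normc_real_ge0 (x : R) : 0 <= x -> Normc.normc x%:C = x.
Proof. by move=> x0; rewrite /= expr0n addr0 sqrtr_sqr ger0_norm. Qed.

Lemma torus_exp_point a : torus (exp_point a).
Proof.
move=> i; rewrite mxE; apply/eqP => /(congr1 (@Normc.normc R)).
rewrite normc_real_ge0 ?expR_ge0 // Normc.normc0.
by apply/eqP; rewrite gt_eqF // expR_gt0.
Qed.

Lemma Log_exp_point a : Log (exp_point a) = a.
Proof.
apply/rowP => i; rewrite !mxE.
by rewrite normc_real_ge0 ?expR_ge0 // expRK.
Qed.

Lemma normcXz (x : R[i]) (m : int) : Normc.normc (x ^ m) = Normc.normc x ^ m.
Proof.
have normcX k : Normc.normc (x ^+ k) = Normc.normc x ^+ k.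
  elim: k => [|k IH]; first by rewrite !expr0 Normc.normc1.
  by rewrite !exprS Normc.normcM IH.
by case: m => k; rewrite /exprz ?Normc.normcV normcX.
Qed.

Lemma norms_at_indep g z : torus z -> monomial_norms g z = norms_at g (Log z).
Proof.
move=> zN0; apply: eq_map => u; rewrite !Normc.normcM; congr (_ * _).
rewrite /mono !(big_morph _ (@Normc.normcM R) (@Normc.normc1 R)).
apply: eq_bigr => i _; rewrite !normcXz; congr (_ ^ _).
rewrite !mxE normc_real_ge0 ?expR_ge0 // lnK // posrE lt_def.
apply/andP; split; last by case: (z 0 i) => x y /=; exact: sqrtr_ge0.
by apply: contraNneq (zN0 i) => /Normc.eq0_normc ->.
Qed.

(* e^{i t} *)
Definition cis (t : R) : R[i] := cos t +i* sin t.

Definition root_point (n : nat) (k : {ffun 'I_r -> 'I_n}) : 'rV[R[i]]_r :=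
  \row_i cis (2 * pi * (k i)%:R / n%:R).

Definition ftilde (n : nat) f : laurent R[i] r :=
  \prod_(k : {ffun 'I_r -> 'I_n}) ltwist (root_point k) f.

Lemma leval_ftilde n f z : torus z ->
  leval (ftilde n f) z =
  \prod_(k : {ffun 'I_r -> 'I_n})
    leval f (\row_i (cis (2 * pi * (k i)%:R / n%:R) * z 0 i)).
Proof.
move=> zN0; rewrite /ftilde.
rewrite (big_morph (fun g => leval g z)
  (fun f g => levalM f g zN0) (leval1 z)).
apply: eq_bigr => k _; rewrite leval_ltwist; congr leval.
by apply/rowP => i; rewrite !mxE.
Qed.

Definition emb (u : 'rV[int]_r) : 'rV[R]_r := \row_i (u 0 i)%:~R.

Definition conv_hull (S : set 'rV[R]_r) : set 'rV[R]_r :=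
  [set x | exists (m : nat) (p : 'I_m -> 'rV[R]_r) (w : 'I_m -> R),
     [/\ forall j, S (p j), forall j, 0 <= w j, \sum_j w j = 1
       & x = \sum_j w j *: p j]].

Definition newton f : set 'rV[R]_r :=
  conv_hull [set emb u | u in [set` msupp f]].

(* Z^r \cap m Delta *)
Definition lattice_points (Delta : set 'rV[R]_r) (m : nat) :
    set 'rV[int]_r :=
  [set v | exists2 x, Delta x & emb v = m%:R *: x].

(* d is an admissible value of d(Delta); [counting] is the cardinality, with
   value +oo on infinite sets. *)
Definition lattice_bound (Delta : set 'rV[R]_r) (d : R) : Prop :=
  forall m : nat, (0 < m)%N ->
    (counting (lattice_points Delta m) * ((m%:R ^+ r)^-1)%:E <= d%:E)%E.

(* c_i(f); the extrema over the polytope are attained. *)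
Definition width f (i : 'I_r) : R :=
  sup [set x 0 i | x in newton f] - inf [set x 0 i | x in newton f].

(* Widths are nonnegative when f is nonzero, so that 0 is a neutral base
   value of this maximum. *)
Definition max_width f : R := \big[Num.max/0]_(i < r) width f i.

End Amoeba.

Section Lopsided.
Variable R : realType.
Implicit Types (s : seq R) (d : R).

Definition lopsided s : Prop :=
  exists i : 'I_(size s), \sum_(j < size s | j != i) s`_j < s`_i.

Definition dsuperlopsided d s : Prop :=
  exists i : 'I_(size s), forall j : 'I_(size s), j != i -> d * s`_j < s`_i.

Definition superlopsided s : Prop := dsuperlopsided (size s).-1%:R s.

End Lopsided.

(* Main.v *)
Require Import Defs.
From HB Require Import structures.
From mathcomp Require Import all_boot all_order all_algebra finmap complex.
From mathcomp Require Import all_classical all_reals all_analysis.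
From mathcomp.multinomials Require Import -(notations) monalg.
From mathcomp Require Import zify lra ring.

Set Implicit Arguments.
Unset Strict Implicit.
Unset Printing Implicit Defensive.

Import Order.TTheory GRing.Theory Num.Theory ComplexField.
Import numFieldNormedType.Exports.

Local Open Scope classical_set_scope.
Local Open Scope ring_scope.
Local Open Scope complex_scope.

(* Let F be the cyclic resultant, b_u the modulus of its monomial of exponent u
   over a, and delta = e^(-n eps).  Along the i-th coordinate direction through
   a point of the fiber of Log over a, F is a constant times a monomial times
   prod_j (z_i^n - beta_j), with at most c n^(r-1) factors and every |beta_j|
   either at most delta or at least 1/delta.  Its coefficients therefore decay
   geometrically, at rate q = c n^(r-1) delta, away from the index counting the
   small beta_j.  At that index the coefficient dominates all the others, so
   that it cannot change along a path of the fiber; it is the i-th coordinate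
   of a fixed exponent N.  Parseval's identity on the fiber (discretized on
   roots of unity of large order, which is exact for Laurent polynomials) turns
   this into
     sum_(u_i = N_i +- n m) b_u^2 <= (3 q^m / (1 - q))^2 sum_u b_u^2.
   For superlopsidedness this is applied term by term.  For lopsidedness, the u
   with max_i |u_i - N_i| = n m split into 2r faces with at most
   (2m + 1)^(r-1) <= 3^(m (r-1)) elements; by the Cauchy-Schwarz inequality a
   face costs only a factor sqrt(3)^(m (r-1)), which the 2^r in the hypothesis
   absorbs.  In both cases the b_u with u != N are small with respect to the
   l^2 norm of b, hence so are they with respect to b_N. *)

(** * Polynomials whose roots avoid an annulus *)

Section ComplexNorm.
Variable R : realType.
Local Notation nc := (@Normc.normc R).
Implicit Types (x y : R[i]).

Lemma normc_ge0 x : 0 <= nc x.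
Proof. by case: x => ? ? /=; exact: sqrtr_ge0. Qed.

Lemma normc_eq0 x : (nc x == 0) = (x == 0).
Proof.
by apply/eqP/eqP => [/Normc.eq0_normc|->] //; exact: Normc.normc0.
Qed.

Lemma normc_gt0 x : (0 < nc x) = (x != 0).
Proof. by rewrite lt_def normc_ge0 andbT normc_eq0. Qed.

Lemma ler_normcD x y : nc (x + y) <= nc x + nc y.
Proof. exact: le_normcD. Qed.

Lemma normc_opp x : nc (- x) = nc x.
Proof. exact: normcN. Qed.

Lemma ler_normcB x y : nc (x - y) <= nc x + nc y.
Proof. by rewrite -(normc_opp y) ler_normcD. Qed.

Lemma lerB_normcB x y : nc x - nc y <= nc (x - y).
Proof. by rewrite lerBlDr -{1}(subrK y x) ler_normcD. Qed.

Lemma normcX x k : nc (x ^+ k) = nc x ^+ k.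
Proof. exact: (normcXz x k). Qed.

End ComplexNorm.

(** * Elementary bounds for powers *)

Section PowerBounds.
Variable R : realType.
Implicit Types x q : R.

(** The inequality e^(-1/6) >= 5/6 gives e^(1/6) <= 6/5, and (6/5)^6 = 2.985984. *)
Lemma expR1_le3 : expR 1 <= 3 :> R.
Proof.
have e6 : expR 1 = expR (1 / 6) ^+ 6 :> R.
  by rewrite -expRM_natl; congr expR; field.
have : 1 - 1 / 6 <= expR (- (1 / 6)) :> R by exact: expR_ge1Dx.
rewrite expRN => le_inv.
have e_gt0 : 0 < expR (1 / 6) :> R by exact: expR_gt0.
have le65 : expR (1 / 6) <= 6 / 5 :> R.
  rewrite -[leRHS]invrK -[leLHS]invrK lef_pV2 ?posrE ?invr_gt0 //; lra.
rewrite e6; apply: (@le_trans _ _ ((6 / 5) ^+ 6)).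
  by rewrite lerXn2r ?nnegrE ?(ltW e_gt0) //; lra.
lra.
Qed.

Lemma exprD1_le3 x k : 0 <= x -> k%:R * x <= 1 -> (1 + x) ^+ k <= 3.
Proof.
move=> x0 kx; apply: le_trans expR1_le3.
apply: (@le_trans _ _ (expR x ^+ k)).
  by rewrite lerXn2r ?nnegrE ?expR_ge1Dx ?expR_ge0 //; lra.
by rewrite -expRM_natl ler_expR mulr_natl -mulr_natl.
Qed.

Lemma expr1B_ge x k : 0 <= x <= 1 -> 1 - k%:R * x <= (1 - x) ^+ k.
Proof.
move=> /andP[x0 x1]; elim: k => [|k IH]; first by rewrite expr0; lra.
rewrite exprS; apply: (@le_trans _ _ ((1 - x) * (1 - k%:R * x))).
  have : 0 <= k%:R * x * x by rewrite !mulr_ge0.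
  by rewrite -natr1; nra.
by rewrite ler_wpM2l //; lra.
Qed.

(** By Bernoulli's inequality 1 - q <= (1 - x)^k, and (1 + x)(1 - x) <= 1. The case k = 0 is apart
    because the hypothesis then gives no bound on x. *)
Lemma exprD1_mul x q k : 0 <= x -> q < 1 -> k%:R * x <= q ->
  (1 + x) ^+ k * (1 - q) <= 1.
Proof.
move=> x0 q1 kxq; case: k kxq => [|k] kxq.
  by rewrite expr0 mul1r; move: kxq; rewrite mul0r; lra.
have x1 : x <= 1.
  have : 0 <= k%:R * x by rewrite mulr_ge0.
  by move: kxq; rewrite -natr1; lra.
apply: (@le_trans _ _ ((1 + x) ^+ k.+1 * (1 - x) ^+ k.+1)).
  rewrite ler_wpM2l //; first by rewrite exprn_ge0 //; lra.
  by apply: le_trans (expr1B_ge _ _); rewrite ?x0 ?x1 // lerD2l lerN2.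
by rewrite -exprMn exprn_ile1 //; nra.
Qed.

End PowerBounds.

(** * Coefficients of polynomials with separated roots *)

Section RootSeparation.
Variable R : realType.
Local Notation nc := (@Normc.normc R).
Implicit Types (b : R[i]) (bs : seq R[i]) (delta q : R).

Definition rootpoly bs : {poly R[i]} := \prod_(b <- bs) ('X - b%:P).

(** The Mahler measure of [rootpoly bs], that is, the product of the moduli of the large roots. *)
Definition mahler bs : R := \prod_(b <- bs) Num.max 1 (nc b).

Definition nsmall bs : nat := count (fun b => nc b < 1) bs.

(** The second alternative is |b| >= 1/delta, written without a division. *)
Definition separated delta bs : bool :=
  all (fun b => (nc b <= delta) || (1 <= delta * nc b)) bs.

Lemma mahler_gt0 bs : 0 < mahler bs.
Proof. by apply: prodr_gt0 => b _; rewrite lt_max ltr01. Qed.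

Lemma nsmall_le bs : (nsmall bs <= size bs)%N.
Proof. exact: count_size. Qed.

Lemma coef_rootpoly_cons b bs l :
  (rootpoly (b :: bs))`_l =
    (if l is l'.+1 then (rootpoly bs)`_l' else 0) - b * (rootpoly bs)`_l.
Proof.
rewrite /rootpoly big_cons mulrC mulrBr coefB coefMX coefMC mulrC.
by case: l.
Qed.

Variant root_sep_spec delta b bs : R -> nat -> Prop :=
| RootSmall of nc b <= delta :
    root_sep_spec delta b bs (mahler bs) (nsmall bs).+1
| RootBig of 1 <= delta * nc b :
    root_sep_spec delta b bs (nc b * mahler bs) (nsmall bs).

Lemma root_sepP delta b bs : 0 <= delta < 1 -> separated delta (b :: bs) ->
  root_sep_spec delta b bs (mahler (b :: bs)) (nsmall (b :: bs)).
Proof.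
move=> /andP[d0 d1] /= /andP[+ _]; rewrite /mahler /nsmall big_cons /=.
have b0 := normc_ge0 b.
case/orP => hb; [have b1 : nc b < 1 by lra | have b1 : 1 <= nc b by nra].
  by rewrite b1 max_l ?ltW // mul1r; constructor.
by rewrite ltNge b1 max_r //; constructor.
Qed.

(* |k - l|, since one of the truncated differences is 0. *)
Definition ndist (k l : nat) : nat := (k - l) + (l - k).

Lemma ndistS_le k l : (ndist k l.+1 <= (ndist k l).+1)%N.
Proof. by rewrite /ndist; lia. Qed.

Lemma ndist_leS k l : (ndist k l <= (ndist k l.+1).+1)%N.
Proof. by rewrite /ndist; lia. Qed.

(** By induction on the roots: multiplication by X - b adds the shifted coefficients to -b times the
    old ones. For a small b the shifted ones carry the peak, which moves by one; for a large b the
    others do, with a factor |b|. The remaining term is off by one index, so that it costs at most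
    delta / q relative to the main one. *)
Lemma coef_rootpoly_le delta q bs l : 0 <= delta < 1 -> 0 < q <= 1 ->
  separated delta bs ->
  nc (rootpoly bs)`_l <=
    (1 + delta / q) ^+ size bs * mahler bs * q ^+ ndist l (nsmall bs).
Proof.
move=> hd /andP[q0 q1]; have [d0 d1] := andP hd.
have lowq k k' : (k <= k'.+1)%N -> q ^+ k' <= q ^+ k / q.
  by move=> lekk; rewrite ler_pdivlMr // -exprSr ler_wiXn2l // ltW.
elim: bs l => [|b bs IH] l sep.
  rewrite /rootpoly /mahler !big_nil expr0 !mul1r coef1 /nsmall /= /ndist.
  case: l => [|l]; first by rewrite [nc _]Normc.normc1.
  by rewrite [nc _]Normc.normc0 exprn_ge0 // ltW.
have seps : separated delta bs by case/andP: sep.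
rewrite coef_rootpoly_cons [size _]/=.
set B := (1 + delta / q) ^+ size bs.
have B0 : 0 <= B by rewrite exprn_ge0 // addr_ge0 // divr_ge0 // ltW.
have M0 := ltW (mahler_gt0 bs).
have BM0 := mulr_ge0 B0 M0.
have {}IH k := IH k seps; rewrite -/B in IH.
have IH' : nc (if l is l'.+1 then (rootpoly bs)`_l' else 0) <=
    B * mahler bs * q ^+ ndist l (nsmall bs).+1.
  case: l => [|l]; last by rewrite /ndist !subSS; exact: IH.
  by rewrite Normc.normc0 mulr_ge0 // exprn_ge0 // ltW.
apply: le_trans (ler_normcB _ _) _; rewrite Normc.normcM exprS -/B.
have b0 := normc_ge0 b; have n0 := normc_ge0 (rootpoly bs)`_l.
case: (root_sepP hd sep) => hb.
- have dk := ndistS_le l (nsmall bs).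
  have le1 := ler_wpM2l BM0 (lowq _ _ dk).
  have le2 : nc b * nc (rootpoly bs)`_l <=
      delta * (B * mahler bs * q ^+ ndist l (nsmall bs)).
    by rewrite ler_pM.
  have le3 := ler_wpM2l d0 le1.
  apply: le_trans (lerD IH' le2) _.
  have -> : (1 + delta / q) * B * mahler bs * q ^+ ndist l (nsmall bs).+1 =
      B * mahler bs * q ^+ ndist l (nsmall bs).+1 +
      delta * (B * mahler bs * (q ^+ ndist l (nsmall bs).+1 / q)) by ring.
  by rewrite lerD2l.
- have dk := ndist_leS l (nsmall bs).
  have le1 := ler_wpM2l BM0 (lowq _ _ dk).
  have le2 : nc b * nc (rootpoly bs)`_l <=
      nc b * (B * mahler bs * q ^+ ndist l (nsmall bs)).
    by rewrite ler_wpM2l.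
  apply: le_trans (lerD (le_trans IH' le1) le2) _.
  set Y := B * mahler bs * (q ^+ ndist l (nsmall bs) / q).
  have Y0 : 0 <= Y by rewrite mulr_ge0 // divr_ge0 ?exprn_ge0 // ltW.
  have -> : (1 + delta / q) * B * (nc b * mahler bs) *
      q ^+ ndist l (nsmall bs) =
      delta * nc b * Y + nc b * (B * mahler bs * q ^+ ndist l (nsmall bs)).
    by rewrite /Y; ring.
  by rewrite lerD2r ler_peMl.
Qed.

Lemma sum_shift_le (g : nat -> R[i]) K :
  \sum_(l < K) nc (if val l is l'.+1 then g l' else 0) <= \sum_(l < K) nc (g l).
Proof.
case: K => [|K]; first by rewrite !big_ord0.
rewrite big_ord_recl big_ord_recr /= [X in X + _ <= _]Normc.normc0 add0r lerDl.
exact: normc_ge0.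
Qed.

(* [m] is the product of the [- b] over the large roots [b]; every other product
   in the expansion of the coefficients is small with respect to it. *)
Lemma rootpoly_ell1 delta bs : 0 <= delta < 1 -> separated delta bs ->
  exists2 m : R[i], nc m = mahler bs &
  forall K : nat,
    \sum_(l < K) nc ((rootpoly bs)`_l - m *+ (l == nsmall bs :> nat)) <=
      ((1 + delta) ^+ size bs - 1) * mahler bs.
Proof.
move=> hd; have [d0 d1] := andP hd.
elim: bs => [|b bs IH] sep.
  exists 1; first by rewrite Normc.normc1 /mahler big_nil.
  move=> K; rewrite expr0 subrr mul0r big1 // => l _.
  by rewrite /rootpoly big_nil coef1 subrr Normc.normc0.
have [|m Hm IHK] := IH; first by case/andP: sep.
set E := (1 + delta) ^+ size bs in IHK *; set M := mahler bs in Hm IHK.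
set s := nsmall bs in IHK; set p := rootpoly bs in IHK.
have E1 : 1 <= E by rewrite exprn_ege1 //; lra.
have M0 : 0 < M := mahler_gt0 bs.
have sump K : \sum_(l < K) nc p`_l <= E * M.
  apply: (@le_trans _ _ (\sum_(l < K)
      (nc (p`_l - m *+ (l == s :> nat)) + nc (m *+ (l == s :> nat))))).
    apply: ler_sum => l _.
    by rewrite -{1}(subrK (m *+ (l == s :> nat)) p`_l) ler_normcD.
  rewrite big_split /=; have := IHK K.
  suff : \sum_(l < K) nc (m *+ (l == s :> nat)) <= M by lra.
  have [ltsK|leKs] := ltnP s K.
    rewrite (bigD1 (Ordinal ltsK)) //= eqxx Hm big1 ?addr0 // => l /negbTE.
    by rewrite -val_eqE /= => ->; rewrite Normc.normc0.
  rewrite big1 ?ltW // => l _; rewrite (ltn_eqF (leq_trans (ltn_ord l) leKs)).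
  by rewrite Normc.normc0.
have b0 := normc_ge0 b.
rewrite [size _]/= exprS -/E.
case: (root_sepP hd sep) => hb; rewrite -/M -/s.
(* A small root shifts the main term and keeps [m]; the error grows by at most delta E M, from (E -
   1) M to ((1 + delta) E - 1) M. *)
- exists m => // K.
  apply: (@le_trans _ _ (\sum_(l < K) nc (p`_l - m *+ (l == s :> nat)) +
      nc b * \sum_(l < K) nc p`_l)).
    pose g k := p`_k - m *+ (k == s).
    apply: le_trans _ (lerD (sum_shift_le g _) (lexx _)).
    rewrite mulr_sumr -big_split; apply: ler_sum => l _ /=.
    rewrite coef_rootpoly_cons -/p -Normc.normcM addrAC.
    apply: le_trans (ler_normcB _ _) _; rewrite lerD2r.
    by case: (val l) => [|k]; rewrite ?subr0 // /g eqSS.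
  have := IHK K; have := sump K.
  set S := \sum_(l < _) _; set T := \sum_(l < _) _ => leS leT.
  have S0 : 0 <= S by apply: sumr_ge0 => l _; exact: normc_ge0.
  have : nc b * S <= delta * (E * M) by rewrite ler_pM.
  by nra.
(* A large root keeps the index and multiplies the main term by -b; the shifted coefficients, of sum
   at most E M <= delta |b| E M, join the error. *)
- exists (- b * m) => [|K]; first by rewrite Normc.normcM normc_opp Hm.
  apply: (@le_trans _ _ (\sum_(l < K) nc p`_l +
      nc b * \sum_(l < K) nc (p`_l - m *+ (l == s :> nat)))).
    apply: le_trans _ (lerD (sum_shift_le (fun k => p`_k) _) (lexx _)).
    rewrite mulr_sumr -big_split; apply: ler_sum => l _ /=.
    rewrite coef_rootpoly_cons -/p -Normc.normcM.
    apply: le_trans _ (ler_normcB _ _); rewrite le_eqVlt; apply/orP; left.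
    apply/eqP; congr nc; case: (_ == s).
      rewrite [m *+ _]mulr1n [_ * m *+ _]mulr1n mulrBr mulNr opprK.
      by rewrite opprD opprK addrA.
    by rewrite [m *+ _]mulr0n [_ * m *+ _]mulr0n !subr0.
  have := sump K; have := ler_wpM2l b0 (IHK K).
  set S := nc b * \sum_(l < _) _; set T := \sum_(l < _) _ => leS leT.
  have : E * M <= delta * nc b * (E * M) by rewrite ler_peMl // mulr_ge0 //; lra.
  by nra.
Qed.

(** By [rootpoly_ell1] the errors at all indices add up to less than a third of the Mahler measure,
    which is the modulus of the main term. *)
Lemma coef_rootpoly_dominant delta bs K : 0 <= delta < 1 ->
  separated delta bs -> (1 + delta) ^+ size bs < 4 / 3 -> (nsmall bs < K)%N ->
  \sum_(l < K | l != nsmall bs :> nat) nc (rootpoly bs)`_l <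
    nc (rootpoly bs)`_(nsmall bs).
Proof.
move=> hd sep Elt sK; have [m Hm /(_ K)] := rootpoly_ell1 hd sep.
have := mahler_gt0 bs; set M := mahler bs in Hm *.
rewrite (bigD1 (Ordinal sK)) //= eqxx mulr1n => M0 le_ell1.
have leq1 : nc m - nc (rootpoly bs)`_(nsmall bs) <=
    nc ((rootpoly bs)`_(nsmall bs) - m).
  by rewrite -(normc_opp (_ - _)) opprB lerB_normcB.
have eq2 : \sum_(l < K | l != Ordinal sK)
    nc ((rootpoly bs)`_l - m *+ (l == nsmall bs :> nat)) =
    \sum_(l < K | l != nsmall bs :> nat) nc (rootpoly bs)`_l.
  apply: eq_big => [l|l /negbTE]; first by rewrite -val_eqE.
  by rewrite -val_eqE /= => ->; rewrite mulr0n subr0.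
rewrite eq2 in le_ell1.
have : ((1 + delta) ^+ size bs - 1) * M < (4 / 3 - 1) * M.
  by rewrite ltr_pM2r // ltrD2r.
move: (\sum_(l < K | _) _) le_ell1 leq1 => T; rewrite Hm; lra.
Qed.

(** On the unit circle a factor w - b has modulus at least 1 - delta if b is small, and at least |b|
    - 1 >= (1 - delta) |b| if b is large. *)
Lemma horner_rootpoly_ge delta bs w : 0 <= delta < 1 -> separated delta bs ->
  nc w = 1 -> (1 - delta) ^+ size bs * mahler bs <= nc (rootpoly bs).[w].
Proof.
move=> hd + w1; have [d0 d1] := andP hd.
elim: bs => [|b bs IH] sep.
  by rewrite /rootpoly /mahler !big_nil hornerC Normc.normc1 expr0 mul1r.
have {}IH : _ := IH (proj2 (andP sep)).
rewrite /rootpoly big_cons hornerM Normc.normcM !hornerE /= exprS.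
have M0 := mahler_gt0 bs.
have le1 : nc w - nc b <= nc (w - b) := lerB_normcB _ _.
have le2 : nc b - nc w <= nc (w - b).
  by rewrite -(normc_opp (_ - _)) opprB lerB_normcB.
have D0 : 0 <= 1 - delta by lra.
have D1 := exprn_ge0 (size bs) D0.
have M1 := ltW M0.
case: (root_sepP hd sep) => hb.
  by rewrite -mulrA ler_pM ?mulr_ge0 //; lra.
rewrite [_ * (nc b * _)]mulrACA ler_pM ?mulr_ge0 ?normc_ge0 //; nra.
Qed.

End RootSeparation.

(** * Slices in a coordinate direction and cyclic resultants *)

Section Slices.
Variables (F : fieldType) (r : nat).
Implicit Types (g : laurent F r) (u : 'rV[int]_r) (y z : 'rV[F]_r) (t : F).

(** The coefficient of t^l in the restriction of g to the line t -> [scale_at i t y]. *)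
Definition lslice g (i : 'I_r) (l : int) y : F :=
  \sum_(u <- msupp g | u 0 i == l) mcoeff u g * mono u y.

Definition scale_at (i : 'I_r) t y : 'rV[F]_r :=
  \row_j (if j == i then t * y 0 j else y 0 j).

(* Because of [absz], to be used only if [e] is a lower bound of the exponents of
   [g] in the direction [i]. *)
Definition slice_poly g (i : 'I_r) (e : int) y : {poly F} :=
  \sum_(u <- msupp g) (mcoeff u g * mono u y) *: 'X^(absz (u 0 i - e)%R).

Lemma mono_scale_at u i t y : mono u (scale_at i t y) = t ^ (u 0 i) * mono u y.
Proof.
rewrite /mono (bigD1 i) //= [in RHS](bigD1 i) //= mxE eqxx expfzMl -mulrA.
congr (_ * (_ * _)); apply: eq_bigr => j /negbTE ji.
by rewrite mxE ji.
Qed.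

Lemma scale_at1 i y : scale_at i 1 y = y.
Proof. by apply/rowP => j; rewrite mxE mul1r if_same. Qed.

Lemma torus_scale_at i t y : t != 0 -> torus y -> torus (scale_at i t y).
Proof. by move=> t0 ty j; rewrite mxE; case: ifP; rewrite ?mulf_neq0. Qed.

Lemma horner_slice_poly g i e y t : t != 0 ->
  (forall u, u \in msupp g -> e <= u 0 i) ->
  t ^ e * (slice_poly g i e y).[t] = leval g (scale_at i t y).
Proof.
move=> t0 ge_e; rewrite /slice_poly horner_sum mulr_sumr /leval.
rewrite !big_seq; apply: eq_bigr => u /ge_e le_eu.
rewrite hornerZ hornerXn mono_scale_at.
have <- : t ^ e * t ^+ absz (u 0 i - e)%R = t ^ u 0 i.
  by rewrite exprnP gez0_abs ?subr_ge0 // -expfzDr // addrC subrK.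
by rewrite mulrCA -!mulrA; congr (_ * _); rewrite mulrC mulrA.
Qed.

Lemma coef_slice_poly g i e y k : (forall u, u \in msupp g -> e <= u 0 i) ->
  (slice_poly g i e y)`_k = lslice g i (e + k%:Z) y.
Proof.
move=> ge_e; rewrite /slice_poly coef_sum /lslice [RHS]big_mkcond /= !big_seq.
apply: eq_bigr => u /ge_e le_eu; rewrite coefZ coefXn.
have -> : (k == absz (u 0 i - e)%R) = (u 0 i == e + k%:Z).
  move: (u 0 i) le_eu => w le_ew; apply/eqP/eqP => [->|->].
    by rewrite gez0_abs ?subr_ge0 // addrC subrK.
  by rewrite addrC addKr.
by case: ifP => _; rewrite ?mulr1 ?mulr0.
Qed.

Lemma size_slice_poly g i e y c :
  (forall u, u \in msupp g -> e <= u 0 i <= e + c%:Z) ->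
  (size (slice_poly g i e y) <= c.+1)%N.
Proof.
move=> le_c; rewrite /slice_poly big_seq.
apply: (big_ind (fun p : {poly F} => size p <= c.+1)%N) => [|p q hp hq|u /le_c hu].
- by rewrite size_poly0.
- by rewrite (leq_trans (size_polyD _ _)) // geq_max hp.
- rewrite (leq_trans (size_scale_leq _ _)) // size_polyXn.
  by move: (u 0 i) hu => w; lia.
Qed.

End Slices.

(** The difference vanishes at 1, 2, 3, ..., which are distinct and nonzero in characteristic 0. *)
Lemma poly_eq_off0 (F : numFieldType) (p q : {poly F}) :
  (forall t, t != 0 -> p.[t] = q.[t]) -> p = q.
Proof.
move=> eq_pq; apply/eqP; rewrite -subr_eq0; apply/eqP; set d := p - q.
apply: (@roots_geq_poly_eq0 _ d [seq k.+1%:R | k <- iota 0 (size d)]).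
- apply/allP => _ /mapP[k _ ->].
  rewrite rootE hornerD hornerN eq_pq ?subrr ?pnatr_eq0 //.
- by rewrite map_inj_uniq ?iota_uniq // => k l /eqP; rewrite eqr_nat => /eqP[].
- by rewrite size_map size_iota.
Qed.

Lemma prod_prim_rootB (F : fieldType) n (z w : F) : n.-primitive_root z ->
  \prod_(k < n) (w - z ^+ k) = w ^+ n - 1.
Proof.
move=> /factor_Xn_sub_1/(congr1 (fun p => p.[w])).
rewrite hornerD hornerN hornerXn hornerC => <-.
by rewrite horner_prod big_mkord; apply: eq_bigr => k _; rewrite hornerXsubC.
Qed.

(** * Roots of unity and cyclic products *)

Section RootsOfUnity.
Variable R : realType.
Implicit Types (s t : R).

Lemma cisD s t : cis (s + t) = cis s * cis t.
Proof.
rewrite /cis cosD sinD; apply/eqP; rewrite eq_complex /=; apply/andP; split => //.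
by rewrite addrC [sin s * _]mulrC (mulrC (cos s)).
Qed.

Lemma cis0 : cis (0 : R) = 1.
Proof. by rewrite /cis cos0 sin0. Qed.

Lemma normc_cis t : Normc.normc (cis t) = 1.
Proof. by rewrite /= cos2Dsin2 sqrtr1. Qed.

Lemma cis_neq0 t : cis t != 0.
Proof. by rewrite -normc_gt0 normc_cis. Qed.

Lemma cis_natM k t : cis (k%:R * t) = cis t ^+ k.
Proof.
elim: k => [|k IH]; first by rewrite mul0r cis0.
by rewrite -natr1 mulrDl mul1r cisD IH exprSr.
Qed.

Definition zeta (n : nat) : R[i] := cis (2 * pi / n%:R).

Lemma zeta_natE n k : cis (2 * pi * k%:R / n%:R) = zeta n ^+ k.
Proof. by rewrite -cis_natM; congr cis; ring. Qed.

(** The half-angle formula turns the hypothesis into sin (t / 2) = 0, and the sine is positive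
    strictly between 0 and pi. *)
Lemma cos_eq1 t : 0 <= t < 2 * pi -> cos t = 1 -> t = 0.
Proof.
move=> /andP[t0 t2] cos1.
have ch : cos t = 1 - 2 * sin (t / 2) ^+ 2.
  have := cos2Dsin2 (t / 2); rewrite [in cos t](_ : t = t / 2 + t / 2); last by field.
  by rewrite cosD -!expr2; lra.
have s0 : sin (t / 2) = 0 by apply/eqP; rewrite -sqrf_eq0; apply/eqP; lra.
apply/eqP; case: (ltgtP 0 t) t0 => // t_gt0 _.
suff : 0 < sin (t / 2) by rewrite s0 ltxx.
by apply: sin_gt0_pi; rewrite divr_gt0 //=; lra.
Qed.

Lemma zeta_prim n : (0 < n)%N -> n.-primitive_root (zeta n).
Proof.
move=> n0; have nR : (0 : R) < n%:R by rewrite ltr0n.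
apply/andP; split => //; apply/forallP => k; apply/eqP.
rewrite unity_rootE -zeta_natE.
have pi0 := pi_gt0 R.
apply/idP/idP => [|/eqP ->]; last first.
  have -> : 2 * pi * n%:R / n%:R = pi *+ 2 :> R.
    by rewrite mulfK ?gt_eqF // mulr2n mulrDl mul1r.
  by rewrite /cis cos2pi -[pi *+ 2]add0r sinD2pi sin0.
rewrite eq_complex /= => /andP[/eqP cos1 _].
rewrite eqn_leq ltn_ord leqNgt; apply/negP => ltkn.
have : 2 * pi * k.+1%:R / n%:R = 0 :> R.
  apply: cos_eq1 => //; apply/andP; split.
    by rewrite divr_ge0 // ?mulr_ge0 // ltW.
  by rewrite ltr_pdivrMr // ltr_pM2l ?ltr_nat // mulr_gt0.
by apply/eqP; rewrite gt_eqF // divr_gt0 // mulr_gt0 ?mulr_gt0 // ltr0n.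
Qed.

(** In a cyclic product, a root x of the polynomial thus becomes the root x^n in the variable
    t^n. *)
Lemma prod_zetaB n (t x : R[i]) : (0 < n)%N -> t != 0 ->
  \prod_(k < n) (zeta n ^+ k * t - x) = (-1) ^+ n.+1 * (t ^+ n - x ^+ n).
Proof.
move=> n0 t0.
transitivity ((-1) ^+ n * (t ^+ n * \prod_(k < n) (x / t - zeta n ^+ k))).
  have expE (c : R[i]) : c ^+ n = \prod_(k < n) c by rewrite prodr_const card_ord.
  rewrite !expE -!big_split; apply: eq_bigr => k _ /=.
  by rewrite mulrBr mulrCA divff // mulr1 mulN1r opprB mulrC.
rewrite prod_prim_rootB ?zeta_prim // expr_div_n exprS.
have := expf_neq0 n t0.
move: (t ^+ n) (x ^+ n) ((-1) ^+ n) => u v w u0.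
by rewrite mulrBr mulr1 [u * (v / u)]mulrC divfK // mulN1r mulNr -mulrN opprB.
Qed.

End RootsOfUnity.

(** Groups the rotations by their components other than i; each group is represented by its member
    with i-th component 0. The successor makes [ord0] available. *)
Lemma prod_ffun_split (V : comNzRingType) (r n : nat) (i : 'I_r)
    (phi : {ffun 'I_r -> 'I_n.+1} -> V) :
  \prod_k phi k =
    \prod_(k : {ffun 'I_r -> 'I_n.+1} | k i == ord0) \prod_(m < n.+1)
      phi [ffun j => if j == i then m else k j].
Proof.
pose upd (k : {ffun 'I_r -> 'I_n.+1}) m : {ffun 'I_r -> 'I_n.+1} :=
  [ffun j => if j == i then m else k j].
rewrite (partition_big (fun k => upd k ord0) (fun k => k i == ord0)) /=; last first.
  by move=> k _; rewrite ffunE eqxx.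
apply: eq_bigr => k /eqP ki0.
rewrite (reindex_onto (upd k) (fun k' => k' i)) /=.
  apply: eq_bigl => m; rewrite ffunE eqxx eqxx andbT; apply/eqP/ffunP => j.
  by rewrite !ffunE; case: eqP => // ->.
move=> k' /eqP eqk; apply/ffunP => j; rewrite ffunE; case: eqP => [-> //|/eqP ji].
by rewrite -eqk ffunE (negbTE ji).
Qed.

Lemma card_ffun_fixed (r n : nat) (i : 'I_r) (m : 'I_n) :
  #|[pred k : {ffun 'I_r -> 'I_n} | k i == m]| = (n ^ r.-1)%N.
Proof.
pose A (j : 'I_r) : {pred 'I_n} := if j == i then pred1 m else predT.
rewrite (_ : #|_| = #|(family A : {pred {ffun 'I_r -> 'I_n}})|); last first.
  apply: eq_card => k; rewrite !inE; apply/eqP/familyP => [km j|/(_ i)].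
    by rewrite /A; case: eqP => [->|//]; rewrite !inE km.
  by rewrite /A eqxx inE => /eqP.
rewrite card_family foldrE big_map big_enum (bigD1 i) //= /A eqxx card1 mul1n.
rewrite (eq_bigr (fun=> n)) => [|j /negbTE ->]; last by rewrite card_ord.
rewrite prod_nat_const; congr (_ ^ _)%N.
by have := cardC1 i; rewrite card_ord => <-; apply: eq_card => j; rewrite !inE.
Qed.

Section Factored.
Variables (R : realType) (n : nat).
Hypothesis n_gt0 : (0 < n)%N.
Local Notation nc := (@Normc.normc R).
Implicit Types (phi : R[i] -> R[i]) (t : R[i]).

(** The form of the cyclic resultant on a coordinate line. It is stable under products, where the
    exponents E and the bounds L on the number of roots add up. *)
Definition factored (delta : R) phi (E : int) (L : nat) : Prop :=
  exists lam bs, [/\ lam != 0, separated delta bs, (size bs <= L)%N &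
    forall t, t != 0 -> phi t = lam * t ^ E * (rootpoly bs).[t ^+ n]].

Lemma factored_prod delta I (s : seq I) (P : pred I)
    (phi_ : I -> R[i] -> R[i]) (E_ : I -> int) (L_ : I -> nat) :
  (forall k, P k -> factored delta (phi_ k) (E_ k) (L_ k)) ->
  factored delta (fun t => \prod_(k <- s | P k) phi_ k t)
    (\sum_(k <- s | P k) E_ k) (\sum_(k <- s | P k) L_ k).
Proof.
move=> Hk; elim: s => [|k s [lam [bs [lam0 sep szs Hs]]]].
  exists 1, [::]; split; rewrite ?oner_neq0 // => t _.
  by rewrite /rootpoly !big_nil hornerC expr0z !mulr1.
have [Pk|nPk] := boolP (P k); last first.
  exists lam, bs; split => //; first by rewrite big_cons (negbTE nPk).
  by move=> t t0; rewrite !big_cons (negbTE nPk) Hs.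
have [lam' [bs' [lam'0 sep' szs' Hs']]] := Hk k Pk.
exists (lam' * lam), (bs' ++ bs); split; first by rewrite mulf_neq0.
- by rewrite /separated all_cat; apply/andP.
- by rewrite size_cat big_cons Pk leq_add.
move=> t t0; rewrite !big_cons Pk Hs // Hs' // /rootpoly big_cat /= hornerM.
by rewrite expfzDr // mulrACA (mulrACA lam').
Qed.

(** The roots x of p become x^n by [prod_zetaB], and |log |x|| >= eps becomes |log |x^n|| >= n eps,
    which is separation by e^(-n eps). *)
Lemma factored_roots (eps : R) (e : int) (p : {poly R[i]}) (c : nat) : p != 0 ->
  (size p <= c.+1)%N ->
  (forall x, x != 0 -> root p x -> eps <= `|ln (nc x)|) ->
  factored (expR (- (n%:R * eps)))
    (fun t => \prod_(k < n)
      ((zeta R n ^+ k * t) ^ e * p.[zeta R n ^+ k * t])) (e * n%:Z) c.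
Proof.
move=> p0 szp sep; have [rs defp] := closed_field_poly_normal p.
have lc0 : lead_coef p != 0 by rewrite lead_coef_eq0.
have szrs : size p = (size rs).+1.
  by rewrite defp size_scale // size_prod_XsubC.
have zeta0 k : zeta R n ^+ k != 0 by rewrite expf_neq0 // cis_neq0.
exists ((\prod_(k < n) zeta R n ^+ k) ^ e *
  (lead_coef p ^+ n * ((-1) ^+ n.+1) ^+ size rs)).
exists [seq x ^+ n | x <- rs]; split.
- rewrite mulf_neq0 ?expfz_neq0 ?mulf_neq0 ?expf_neq0 ?oppr_eq0 ?oner_neq0 //.
  by apply/prodf_neq0 => k _.
- apply/allP => _ /mapP[x xrs ->]; rewrite normcX.
  (* On the root 0 the hypothesis says nothing; since n > 0 its n-th power is 0, hence small. *)
  have [->|x0] := eqVneq x 0.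
    by rewrite Normc.normc0 expr0n eqn0Ngt n_gt0 expR_ge0.
  have rx : root p x by rewrite defp rootZ // root_prod_XsubC.
  have nx : 0 < nc x by rewrite normc_gt0.
  have := sep x x0 rx; rewrite ler_normr expRN => /orP[le_eps|le_eps].
    apply/orP; right; rewrite mulrC ler_pdivlMr ?expR_gt0 // mul1r expRM_natl.
    by rewrite lerXn2r ?nnegrE ?expR_ge0 ?(ltW nx) // -[nc x]lnK ?posrE // ler_expR.
  apply/orP; left; rewrite -expRN -mulrN expRM_natl.
  rewrite lerXn2r ?nnegrE ?expR_ge0 ?(ltW nx) // -[nc x]lnK ?posrE // ler_expR.
  by rewrite lerNr.
- by rewrite size_map -ltnS -szrs.
move=> t t0; rewrite big_split /=.
have -> : \prod_(k < n) (zeta R n ^+ k * t) ^ e =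
    (\prod_(k < n) zeta R n ^+ k) ^ e * t ^ (e * n%:Z).
  have expE : forall m, \prod_(k < m) (zeta R n ^+ k * t) ^ e =
      (\prod_(k < m) zeta R n ^+ k) ^ e * t ^ (e * m%:Z).
    elim=> [|m IH]; first by rewrite !big_ord0 mulr0 expr0z exp1rz mulr1.
    rewrite !big_ord_recr /= IH -addn1 PoszD mulrDr mulr1 expfzDr // !expfzMl.
    by rewrite mulrACA.
  exact: expE.
have -> : \prod_(k < n) p.[zeta R n ^+ k * t] = lead_coef p ^+ n *
    ((-1) ^+ n.+1) ^+ size rs * (rootpoly [seq x ^+ n | x <- rs]).[t ^+ n].
  rewrite /rootpoly big_map horner_prod.
  transitivity (\prod_(k < n) (lead_coef p * \prod_(x <- rs) (zeta R n ^+ k * t - x))).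
    apply: eq_bigr => k _; rewrite {1}defp hornerZ horner_prod; congr (_ * _).
    by apply: eq_bigr => x _; rewrite hornerXsubC.
  rewrite big_split /= prodr_const card_ord exchange_big /= -mulrA; congr (_ * _).
  rewrite -[size rs]count_predT -iter_mulr_1 -big_const_seq -big_split /=.
  by apply: eq_bigr => x _; rewrite prod_zetaB // hornerXsubC.
by rewrite -!mulrA; congr (_ * _); rewrite !mulrA; congr (_ * _); rewrite -mulrA mulrC.
Qed.

End Factored.

(** * Slices of the cyclic resultant *)

Section SliceOfCyclicResultant.
Variables (R : realType) (r : nat) (f : laurent R[i] r) (a : 'rV[R]_r) (eps : R).
Variable n : nat.
Hypotheses (eps_gt0 : 0 < eps) (n_gt0 : (0 < n)%N).
Hypothesis clear_a : forall z, torus z -> leval f z = 0 ->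
  eps <= eucl_dist a (Log z).
Local Notation nc := (@Normc.normc R).
Local Notation F := (ftilde n f).
Local Notation delta := (expR (- (n%:R * eps))).
Implicit Types (y z : 'rV[R[i]]_r) (i : 'I_r).

Definition fiber b y : Prop := torus y /\ @Log R r y = b.

Lemma fiber_normc y i : fiber a y -> nc (y 0 i) = expR (a 0 i).
Proof. by case=> ty <-; rewrite mxE lnK // posrE normc_gt0. Qed.

Lemma fiberP y : (forall i, nc (y 0 i) = expR (a 0 i)) -> fiber a y.
Proof.
move=> ny; split=> [i|]; first by rewrite -normc_gt0 ny expR_gt0.
by apply/rowP => i; rewrite mxE ny expRK.
Qed.

Lemma fiber_leval_neq0 y : fiber a y -> leval f y != 0.
Proof.
case=> ty Logy; apply/eqP => /(clear_a ty); rewrite Logy /eucl_dist big1.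
  by rewrite sqrtr0 leNgt eps_gt0.
by move=> i _; rewrite subrr expr0n.
Qed.

(** Only the i-th coordinate of [Log] moves, by log |x|. The distance to the amoeba thereby bounds
    the roots of f on a coordinate line away from the unit circle. *)
Lemma eucl_dist_scale_at y i x : fiber a y -> x != 0 ->
  eucl_dist a (Log (scale_at i x y)) = `|ln (nc x)|.
Proof.
move=> fy x0; have [ty Logy] := fy; rewrite /eucl_dist (bigD1 i) //= big1.
  rewrite addr0 !mxE eqxx Normc.normcM fiber_normc // lnM ?posrE ?expR_gt0 //.
    by rewrite expRK opprD addrC addrNK sqrrN sqrtr_sqr.
  by rewrite normc_gt0.
move=> j /negbTE ji; rewrite !mxE ji fiber_normc // expRK.
by rewrite subrr expr0n.
Qed.

Section Direction.
Variables (i : 'I_r) (e : int) (c : nat).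
Hypothesis width_i : forall u, u \in msupp f -> e <= u 0 i <= e + c%:Z.

(** The rotations in the direction i form a one-variable cyclic product; there is one for each of
    the n^(r-1) rotations in the other directions. Those move y inside its fiber, so that
    [factored_roots] applies to each product, with at most c roots. *)
Lemma factored_ftilde y : fiber a y ->
  factored n delta (fun t => leval F (scale_at i t y))
    (e * (n * n ^ r.-1)%:Z) (c * n ^ r.-1).
Proof.
move=> fy; case: n n_gt0 => // m m0.
pose tw (k : {ffun 'I_r -> 'I_m.+1}) z : 'rV[R[i]]_r :=
  \row_j (zeta R m.+1 ^+ k j * z 0 j).
have fib_tw k : fiber a (tw k y).
  apply: fiberP => j; rewrite mxE Normc.normcM normcX /zeta normc_cis expr1n.
  by rewrite mul1r fiber_normc.
have lower u : u \in msupp f -> e <= u 0 i by case/width_i/andP.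
have : factored m.+1 (expR (- (m.+1%:R * eps)))
    (fun t => \prod_(k : {ffun 'I_r -> 'I_m.+1} | k i == ord0) \prod_(l < m.+1)
      ((zeta R m.+1 ^+ l * t) ^ e *
        (slice_poly f i e (tw k y)).[zeta R m.+1 ^+ l * t]))
    (\sum_(k : {ffun 'I_r -> 'I_m.+1} | k i == ord0) e * m.+1%:Z)
    (\sum_(k : {ffun 'I_r -> 'I_m.+1} | k i == ord0) c).
  apply: factored_prod => k _; apply: factored_roots => //.
  - apply: contraNneq (fiber_leval_neq0 (fib_tw k)) => p0.
    by rewrite -(scale_at1 i (tw k y)) -(@horner_slice_poly _ _ _ _ e)
      ?oner_neq0 // p0 horner0 mulr0.
  - exact: size_slice_poly.
  - move=> x x0 /rootP rx; rewrite -(eucl_dist_scale_at i (fib_tw k) x0).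
    apply: clear_a; first by apply: torus_scale_at => //; case: (fib_tw k).
    by rewrite -(@horner_slice_poly _ _ _ _ e) // rx mulr0.
rewrite sumr_const sum_nat_const card_ffun_fixed mulnC.
have -> : e * m.+1%:Z *+ (m.+1 ^ r.-1) = e * (m.+1 * m.+1 ^ r.-1)%:Z.
  by rewrite -mulr_natr natz -mulrA -PoszM.
case=> lam [bs [lam0 sep szbs def_prod]]; exists lam, bs; split => // t t0.
rewrite -def_prod // leval_ftilde; last by apply: torus_scale_at => //; case: fy.
rewrite (prod_ffun_split i); apply: eq_bigr => k /eqP ki0.
apply: eq_bigr => l _.
have zt0 : zeta R m.+1 ^+ l * t != 0.
  by rewrite mulf_neq0 // expf_neq0 // cis_neq0.
rewrite (horner_slice_poly _ zt0 lower).
congr leval; apply/rowP => j; rewrite !mxE ffunE zeta_natE.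
case: (eqVneq j i) => [->|//]; rewrite ki0 expr0 mul1r mulrA //.
Qed.

(** Compares the coefficients of the powers of t on both sides of [factored_ftilde]. *)
Lemma ftilde_slices y : fiber a y ->
  exists2 lam, lam != 0 & exists bs,
  [/\ separated delta bs, (size bs <= c * n ^ r.-1)%N,
      leval F y = lam * (rootpoly bs).[1],
      forall j : nat, lslice F i (e * (n * n ^ r.-1)%:Z + (n * j)%:Z) y =
        lam * (rootpoly bs)`_j &
      forall l : int, (forall j : nat, l != e * (n * n ^ r.-1)%:Z + (n * j)%:Z) ->
        lslice F i l y = 0].
Proof.
move=> fy; have [lam [bs [lam0 sep szbs defF]]] := factored_ftilde fy.
exists lam => //; exists bs.
set E := e * _ in defF *.
(* [G] is a crude lower bound of the i-th exponents of the resultant. Division by t^B turns both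
   sides into genuine polynomials. *)
pose G : int := - \sum_(u <- msupp F) `|u 0 i|.
pose B : int := Num.min E G.
have leB u : u \in msupp F -> B <= u 0 i.
  move=> uF; apply: (@le_trans _ _ G); first by rewrite ge_min lexx orbT.
  rewrite lerNl (big_fsetD1 u) //=; apply: (@le_trans _ _ `|u 0 i|).
    by rewrite -normrN ler_norm.
  by rewrite lerDl sumr_ge0.
have leBE : B <= E by rewrite ge_min lexx.
have defP : slice_poly F i B y =
    lam *: ('X^(absz (E - B)%R) * (rootpoly bs \Po 'X^n)).
  apply: poly_eq_off0 => t t0; apply: (mulfI (expfz_neq0 B t0)).
  rewrite horner_slice_poly // defF // hornerZ hornerM hornerXn horner_comp.
  rewrite hornerXn (exprnP t (absz _)) gez0_abs ?subr_ge0 // [RHS]mulrCA -mulrA.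
  congr (_ * _).
  by rewrite mulrA -expfzDr // addrC subrK.
have coefE k : lslice F i (B + k%:Z) y =
    lam * ('X^(absz (E - B)%R) * (rootpoly bs \Po 'X^n))`_k.
  by rewrite -coef_slice_poly // defP coefZ.
split => //.
- by rewrite -{1}(scale_at1 i y) defF ?oner_neq0 // expr1n exp1rz mulr1.
- move=> j; have -> : E + (n * j)%:Z = B + (absz (E - B)%R + n * j)%N%:Z.
    by rewrite PoszD gez0_abs ?subr_ge0 // addrA [B + _]addrC subrK.
  rewrite coefE coefXnM ltnNge leq_addr /= addKn.
  by rewrite coef_comp_poly_Xn // dvdn_mulr // mulKn.
- move=> l nEl; have [ltlB|leBl] := ltP l B.
    rewrite /lslice big_seq_cond big1 // => u /andP[/leB leBu /eqP lu].
    by move: ltlB; rewrite -lu ltNge leBu.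
  have -> : l = B + (absz (l - B)%R)%:Z.
    by rewrite gez0_abs ?subr_ge0 // addrC subrK.
  rewrite coefE coefXnM; case: ltnP => [|lek]; first by rewrite mulr0.
  rewrite coef_comp_poly_Xn //; case: dvdnP => [[j defk]|]; last by rewrite mulr0.
  have := nEl j; rewrite mulnC -defk => /eqP[].
  by rewrite -subzn // !gez0_abs ?subr_ge0 //; ring.
Qed.

End Direction.
End SliceOfCyclicResultant.

(** * The fiber of Log and Parseval's identity *)

Section TorusPoints.
Variables (R : realType) (r : nat).
Local Notation nc := (@Normc.normc R).
Implicit Types (a th : 'rV[R]_r) (u : 'rV[int]_r) (i : 'I_r).

(** Polar coordinates on the fiber over a, with th the vector of arguments. *)
Definition torus_point a th : 'rV[R[i]]_r :=
  \row_i ((expR (a 0 i))%:C * cis (th 0 i)).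

Definition pairing u th : R := \sum_i (u 0 i)%:~R * th 0 i.

Lemma fiber_torus_point a th : fiber a (torus_point a th).
Proof.
apply: fiberP => i; rewrite mxE Normc.normcM normc_cis mulr1.
by rewrite normc_real_ge0 ?expR_ge0.
Qed.


Lemma cisN (t : R) : cis (- t) = (cis t)^-1.
Proof.
apply: (mulfI (cis_neq0 t)); rewrite -cisD subrr cis0 divff //; exact: cis_neq0.
Qed.

Lemma cisXz (t : R) (m : int) : cis t ^ m = cis (m%:~R * t).
Proof.
case: m => k; first by rewrite -exprnP -cis_natM.
by rewrite NegzE -exprnN mulrNz mulNr cisN cis_natM.
Qed.

Lemma mono_torus_point a th u :
  mono u (torus_point a th) = (expR (pairing u a))%:C * cis (pairing u th).
Proof.
rewrite /mono /pairing.
have exp_sum : (expR (\sum_i (u 0 i)%:~R * a 0 i))%:C =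
    \prod_i ((expR (a 0 i))%:C ^ (u 0 i)) :> R[i].
  rewrite (big_morph expR (@expRD R) (@expR0 R)) rmorph_prod.
  apply: eq_bigr => i _ /=.
  case: (u 0 i) => k; first by rewrite -exprnP -rmorphXn -expRM_natl.
  by rewrite NegzE -exprnN mulrNz mulNr expRN expRM_natl fmorphV rmorphXn.
have cis_sum : cis (\sum_i (u 0 i)%:~R * th 0 i) = \prod_i (cis (th 0 i) ^ (u 0 i)).
  rewrite (big_morph (@cis R) (@cisD R) (@cis0 R)).
  by apply: eq_bigr => i _; rewrite cisXz.
rewrite exp_sum cis_sum -big_split; apply: eq_bigr => i _.
by rewrite mxE expfzMl.
Qed.

Lemma normc_mono a th u : nc (mono u (torus_point a th)) = expR (pairing u a).
Proof.
by rewrite mono_torus_point Normc.normcM normc_cis mulr1 normc_real_ge0 ?expR_ge0.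
Qed.

Lemma pairingZ u th (t : R) : pairing u (t *: th) = t * pairing u th.
Proof.
rewrite /pairing mulr_sumr; apply: eq_bigr => i _; rewrite mxE; ring.
Qed.

Definition ccontinuous (g : R -> R[i]) : Prop :=
  continuous (fun t : R => complex.Re (g t)) /\
  continuous (fun t : R => complex.Im (g t)).

Lemma ccontinuous_cst (x : R[i]) : ccontinuous (fun=> x).
Proof. by split=> t; apply: cvg_cst. Qed.

Lemma ccontinuousD g h : ccontinuous g -> ccontinuous h ->
  ccontinuous (fun t => g t + h t).
Proof.
move=> [cg1 cg2] [ch1 ch2]; split=> t.
  rewrite (_ : (fun t => _) = (fun t => complex.Re (g t)) \+
      (fun t => complex.Re (h t))).
    by apply: cvgD; [exact: cg1|exact: ch1].
  by apply/funext => s /=; case: (g s) => ? ?; case: (h s).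
rewrite (_ : (fun t => _) = (fun t => complex.Im (g t)) \+
    (fun t => complex.Im (h t))).
  by apply: cvgD; [exact: cg2|exact: ch2].
by apply/funext => s /=; case: (g s) => ? ?; case: (h s).
Qed.

Lemma ccontinuousMc g (x : R[i]) : ccontinuous g -> ccontinuous (fun t => x * g t).
Proof.
move=> [cg1 cg2]; case: x => x1 x2; split=> t.
  rewrite (_ : (fun t => _) = (fun t =>
      x1 * complex.Re (g t) - x2 * complex.Im (g t))).
    by apply: cvgB; apply: cvgMr; [exact: cg1|exact: cg2].
  by apply/funext => s /=; case: (g s).
rewrite (_ : (fun t => _) = (fun t =>
    x1 * complex.Im (g t) + x2 * complex.Re (g t))).
  by apply: cvgD; apply: cvgMr; [exact: cg2|exact: cg1].
by apply/funext => s /=; case: (g s) => ? ? /=; rewrite addrC; ring.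
Qed.

Lemma ccontinuous_cis (w : R) : ccontinuous (fun t => cis (t * w)).
Proof.
have mw : continuous (fun t : R => t * w) by move=> t; apply: cvgMl; exact: cvg_id.
split=> t /=.
  exact: (@continuous_comp _ _ _ (fun t : R => t * w) (@cos R) t (mw t)
    (@continuous_cos R _)).
exact: (@continuous_comp _ _ _ (fun t : R => t * w) (@sin R) t (mw t)
  (@continuous_sin R _)).
Qed.

Lemma continuous_normc g : ccontinuous g -> continuous (fun t : R => nc (g t)).
Proof.
move=> [cg1 cg2] t.
rewrite (_ : (fun t => _) = Num.sqrt \o
    (fun t => complex.Re (g t) ^+ 2 + complex.Im (g t) ^+ 2)).
  apply: continuous_comp; last exact: sqrt_continuous.
  by apply: cvgD; rewrite !expr2; apply: cvgM; (exact: cg1 || exact: cg2).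
by apply/funext => s /=; case: (g s).
Qed.

(** A slice is a finite sum of constants times e^(i t s), with real s. This feeds the intermediate
    value theorem in [dominant_index]. *)
Lemma continuous_normc_lslice (g : laurent R[i] r) i l a th :
  continuous (fun t : R => nc (lslice g i l (torus_point a (t *: th)))).
Proof.
apply: continuous_normc; rewrite /lslice.
elim: (enum_fset (msupp g)) => [|u s IH].
  rewrite (_ : (fun t => _) = (fun=> 0)); first exact: ccontinuous_cst.
  by apply/funext => t; rewrite big_nil.
rewrite (_ : (fun t => _) = (fun t =>
  (if u 0 i == l then mcoeff u g * mono u (torus_point a (t *: th)) else 0) +
  \sum_(v <- s | v 0 i == l) mcoeff v g * mono v (torus_point a (t *: th)))).
  apply: ccontinuousD; last exact: IH.
  case: (u 0 i == l); last exact: ccontinuous_cst.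
  rewrite (_ : (fun t => _) = (fun t =>
    (mcoeff u g * (expR (pairing u a))%:C) * cis (t * pairing u th))).
    exact/ccontinuousMc/ccontinuous_cis.
  by apply/funext => t; rewrite mono_torus_point pairingZ mulrA.
by apply/funext => t; rewrite big_cons; case: ifP => _; rewrite ?add0r.
Qed.

End TorusPoints.

Lemma lt_quarter_lt1 (R : realType) (q : R) : q < 1 / 4 -> q < 1.
Proof. lra. Qed.

Lemma exprD1_lt43 (R : realType) (x q : R) k : 0 <= x -> q < 1 / 4 ->
  k%:R * x <= q -> (1 + x) ^+ k < 4 / 3.
Proof.
move=> x0 q4 kxq.
have := exprD1_mul x0 (lt_quarter_lt1 q4) kxq.
have : 0 <= (1 + x) ^+ k by rewrite exprn_ge0 // addr_ge0.
by nra.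
Qed.

(** * The dominant index is constant on the fiber *)

Section DominantIndex.
Variables (R : realType) (r : nat) (f : laurent R[i] r) (a : 'rV[R]_r) (eps : R).
Variable n : nat.
Hypotheses (eps_gt0 : 0 < eps) (n_gt0 : (0 < n)%N).
Hypothesis clear_a : forall z, torus z -> leval f z = 0 ->
  eps <= eucl_dist a (Log z).
Variables (i : 'I_r) (e : int) (c : nat) (q : R).
Hypothesis width_i : forall u, u \in msupp f -> e <= u 0 i <= e + c%:Z.
Local Notation nc := (@Normc.normc R).
Local Notation F := (ftilde n f).
Local Notation delta := (expR (- (n%:R * eps))).
Local Notation L := (c * n ^ r.-1)%N.
Hypotheses (q_gt0 : 0 < q) (q_lt : q < 1 / 4) (q_ge : L%:R * delta <= q).
Local Notation expo j := (e * (n * n ^ r.-1)%:Z + (n * j)%:Z).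

(** The first clause compares slices with the value of the resultant, so that Parseval's identity
    can be applied to both sides. The second one determines s among the indices up to L and is an
    open condition. *)
Definition dominant_at (s : nat) y : Prop :=
  [/\ forall j : nat, nc (lslice F i (expo j) y) * (1 - q) <=
        3 * q ^+ ndist j s * nc (leval F y),
      \sum_(j < L.+1 | j != s :> nat) nc (lslice F i (expo j) y) <
        nc (lslice F i (expo s) y) &
      forall l : int, (forall j : nat, l != expo j) -> lslice F i l y = 0].

(** The index is the number of small roots. The factor 3 bounds (1 + delta / q)^L, as L delta / q <=
    1; the factor 1 - q is a lower bound of (1 - delta)^L, by which the value at t = 1 controls the
    Mahler measure. *)
Lemma dominant_at_exists y : fiber a y -> exists2 s, (s <= L)%N & dominant_at s y.
Proof.
move=> fy.
have [lam lam0 [bs [sep szbs defF slE sl0]]] :=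
  ftilde_slices eps_gt0 n_gt0 clear_a width_i fy.
have d_gt0 : 0 < delta := expR_gt0 _.
have d_lt1 : delta < 1 by rewrite expR_lt1 oppr_lt0 mulr_gt0 // ltr0n.
have hd : 0 <= delta < 1 by rewrite ltW.
have szd : (size bs)%:R * delta <= q.
  by apply: le_trans q_ge; rewrite ler_wpM2r ?ler_nat // ltW.
have lam_gt0 : 0 < nc lam by rewrite normc_gt0.
have M0 := ltW (mahler_gt0 bs).
have q1 : q < 1 by exact: lt_quarter_lt1.
exists (nsmall bs); first exact: leq_trans (nsmall_le _) szbs.
split=> // [j|].
- rewrite slE defF !Normc.normcM [leRHS]mulrCA -mulrA ler_pM2l //.
  have q01 : 0 < q <= 1 by rewrite q_gt0 ltW.
  have le_coef := coef_rootpoly_le j hd q01 sep.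
  have le3 : (1 + delta / q) ^+ size bs <= 3.
    apply: exprD1_le3; first by rewrite divr_ge0 // ltW.
    by rewrite mulrA ler_pdivrMr // mul1r.
  have leM : (1 - q) * mahler bs <= nc (rootpoly bs).[1].
    apply: le_trans (horner_rootpoly_ge hd sep (@Normc.normc1 R)).
    rewrite ler_wpM2r //; apply: le_trans (expr1B_ge _ _); last by rewrite !ltW.
    by rewrite lerD2l lerN2.
  have qd0 : 0 <= q ^+ ndist j (nsmall bs) by rewrite exprn_ge0 // ltW.
  apply: (@le_trans _ _ (3 * mahler bs * q ^+ ndist j (nsmall bs) * (1 - q))).
    rewrite ler_wpM2r //; first by rewrite subr_ge0 ltW.
    by apply: le_trans le_coef _; rewrite ler_wpM2r // ler_wpM2r.
  rewrite [X in X <= _](_ : _ =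
    3 * q ^+ ndist j (nsmall bs) * ((1 - q) * mahler bs)).
    by rewrite ler_wpM2l // mulr_ge0.
  by ring.
- rewrite slE Normc.normcM; under eq_bigr do rewrite slE Normc.normcM.
  rewrite -mulr_sumr ltr_pM2l //; apply: (coef_rootpoly_dominant hd sep).
    exact: exprD1_lt43 (ltW d_gt0) q_lt szd.
  by rewrite ltnS (leq_trans (nsmall_le _) szbs).
Qed.

(** The index of [dominant_at_exists] depends on the point a priori. The fiber is connected and the
    dominance strict, so that it cannot jump. *)
Lemma dominant_index : exists2 s, (s <= L)%N &
  forall th, dominant_at s (torus_point a th).
Proof.
have [s0 le_s0 dom0] := dominant_at_exists (fiber_torus_point a 0).
exists s0; first exact: le_s0.
move=> th; have [s le_s dom] := dominant_at_exists (fiber_torus_point a th).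
suff -> : s0 = s by [].
apply/eqP/negP => /negP ne_s.
(* [h] is positive where [s0] dominates and negative where another index does, so
   that it has no zero on the segment from the origin to [th]. *)
pose g j (t : R) := nc (lslice F i (expo j) (torus_point a (t *: th))).
pose h t := g s0 t - \sum_(j < L.+1 | j != s0 :> nat) g j t.
have le_sum k t : (k <= L)%N -> k != s0 ->
    g k t <= \sum_(j < L.+1 | j != s0 :> nat) g j t.
  move=> leK nk; rewrite (bigD1 (Ordinal (leK : (k < L.+1)%N))) //= lerDl.
  by apply: sumr_ge0 => j _; exact: normc_ge0.
have le_sum' k t : (k <= L)%N -> s0 != k ->
    g s0 t <= \sum_(j < L.+1 | j != k :> nat) g j t.
  move=> leK nk; rewrite (bigD1 (Ordinal (le_s0 : (s0 < L.+1)%N))) //= lerDl.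
  by apply: sumr_ge0 => j _; exact: normc_ge0.
have h_neg k t : (k <= L)%N -> s0 != k ->
    dominant_at k (torus_point a (t *: th)) -> h t < 0.
  move=> leK nk [_ domk _]; rewrite subr_lt0.
  apply: le_lt_trans (le_sum' k t leK nk) _; apply: lt_le_trans domk _.
  by apply: le_sum => //; rewrite eq_sym.
have h0 : 0 < h 0.
  by rewrite subr_gt0 /g scale0r; have [_] := dom0.
have h1 : h 1 < 0 by apply: (h_neg s 1 le_s ne_s); rewrite scale1r.
have ch : continuous h.
  move=> t; apply: cvgB; first exact: continuous_normc_lslice.
  by apply: (cvg_big add_continuous) => j _; exact: continuous_normc_lslice.
have min0max (u v : R) : 0 < u -> v < 0 -> Num.min u v <= 0 <= Num.max u v.
  by move=> u0 v0; rewrite ge_min le_max (ltW u0) (ltW v0) orbT.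
have [||t _ ht] := @IVT R h 0 1 0 ler01.
- by apply: continuous_subspaceT => t; exact: ch.
- exact: min0max.
have [k le_k domk] := dominant_at_exists (fiber_torus_point a (t *: th)).
have [eqk|nk] := eqVneq s0 k; last by have := h_neg k t le_k nk domk; rewrite ht ltxx.
by case: domk => _ + _; rewrite -eqk -subr_gt0 -/(h t) ht ltxx.
Qed.

End DominantIndex.

(** * Parseval's identity on a grid of roots of unity *)

Section Parseval.
Variables (R : realType) (r : nat).
Local Notation nc := (@Normc.normc R).
Implicit Types (a th : 'rV[R]_r) (u v w : 'rV[int]_r).

Definition grid (K : nat) (k : {ffun 'I_r -> 'I_K}) : 'rV[R]_r :=
  \row_j (2 * pi * (k j)%:R / K%:R).

Lemma sqr_normcE (x : R[i]) : (nc x ^+ 2)%:C = x * x^*%C.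
Proof. by rewrite rmorphXn -sqr_normc. Qed.

Lemma conjc_cis (t : R) : (cis t)^*%C = cis (- t).
Proof. by rewrite /cis cosN sinN. Qed.

Lemma conjcM (x y : R[i]) : (x * y)^*%C = x^*%C * y^*%C.
Proof. exact: (rmorphM (@conjc R)). Qed.

Lemma pairingB u v th : pairing (u - v) th = pairing u th - pairing v th.
Proof.
rewrite /pairing -sumrB; apply: eq_bigr => j _.
by rewrite !mxE intrD mulrDl mulrNz mulNr.
Qed.

(** Orthogonality of the characters of (Z/K)^r: as |w_j| < K, a nonzero w is a nontrivial character,
    and one of the factors is a vanishing geometric sum. *)
Lemma sum_grid K w : (forall j, `|w 0 j| < K%:Z) ->
  \sum_(k : {ffun 'I_r -> 'I_K}) cis (pairing w (grid k)) =
  ((w == 0) * K ^ r)%:R :> R[i].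
Proof.
move=> ltwK.
transitivity (\prod_(j < r) \sum_(m < K) (zeta R K ^ (w 0 j)) ^+ m).
  rewrite bigA_distr_bigA; apply: eq_bigr => k _.
  rewrite /pairing (big_morph (@cis R) (@cisD R) (@cis0 R)).
  apply: eq_bigr => j _; rewrite mxE -cisXz zeta_natE.
  exact: (exprzAC _ (k j)).
have [->|w0] := eqVneq w 0.
  rewrite mul1n natrX -[r in RHS]card_ord -prodr_const; apply: eq_bigr => j _.
  rewrite mxE expr0z (eq_bigr (fun=> 1)) => [|m _]; last by rewrite expr1n.
  by rewrite sumr_const card_ord.
have [j wj] : exists j, w 0 j != 0.
  apply/existsP; apply: contraNT w0 => /existsPn w0.
  by apply/eqP/rowP => j; rewrite mxE; apply/eqP; have := w0 j; rewrite negbK.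
rewrite mul0n (bigD1 j) //=.
have K0 : (0 < K)%N by rewrite -ltz_nat; apply: le_lt_trans (ltwK j).
have prim := zeta_prim R K0.
have zK : (zeta R K ^ (w 0 j)) ^+ K = 1.
  by rewrite exprnP exprz_exp mulrC -exprz_exp -exprnP prim_expr_order // exp1rz.
have z1 : zeta R K ^ (w 0 j) != 1.
  have ltabs : (absz (w 0%R j) < K)%N by rewrite -ltz_nat abszE.
  have dvd_absz : (K %| absz (w 0%R j))%N = (zeta R K ^+ absz (w 0%R j) == 1).
    by rewrite (prim_order_dvd prim).
  rewrite gtnNdvd ?absz_gt0 // in dvd_absz.
  case: (w 0 j) dvd_absz => m /=; first by move=> <-.
  rewrite NegzE -exprnN invr_eq1 => <- //.
have /eqP := subrX1 (zeta R K ^ (w 0 j)) K.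
rewrite zK subrr eq_sym mulf_eq0 subr_eq0 (negbTE z1) /= => /eqP ->.
by rewrite mul0r.
Qed.

Lemma parseval K (s : seq 'rV[int]_r) (b : 'rV[int]_r -> R[i]) : uniq s ->
  {in s &, forall u v, forall j, `|u 0 j - v 0 j| < K%:Z} ->
  \sum_(k : {ffun 'I_r -> 'I_K})
     nc (\sum_(u <- s) b u * cis (pairing u (grid k))) ^+ 2 =
  (K ^ r)%:R * \sum_(u <- s) nc (b u) ^+ 2.
Proof.
move=> us sep; apply: (@complexI R); rewrite rmorphM !rmorph_sum rmorph_nat /=.
transitivity (\sum_(u <- s) \sum_(v <- s) b u * (b v)^*%C *
    \sum_(k : {ffun 'I_r -> 'I_K}) cis (pairing (u - v) (grid k))).
  have sqr_sum (g : 'rV[int]_r -> R[i]) :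
      (nc (\sum_(u <- s) g u) ^+ 2)%:C = \sum_(u <- s) \sum_(v <- s) g u * (g v)^*%C.
    rewrite sqr_normcE rmorph_sum /= mulr_suml.
    by apply: eq_bigr => u _; rewrite mulr_sumr.
  rewrite (eq_bigr _ (fun k _ => sqr_sum _)).
  rewrite exchange_big /=; apply: eq_bigr => u _.
  rewrite exchange_big /=; apply: eq_bigr => v _.
  rewrite mulr_sumr; apply: eq_bigr => k _.
  by rewrite conjcM conjc_cis mulrACA -cisD pairingB.
rewrite mulr_sumr !big_seq; apply: eq_bigr => u us'.
have gridE v : v \in s ->
    \sum_(k : {ffun 'I_r -> 'I_K}) cis (pairing (u - v) (grid k)) =
    ((u == v) * K ^ r)%:R :> R[i].
  by move=> vs; rewrite sum_grid ?subr_eq0 // => j; rewrite !mxE; apply: sep.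
rewrite (bigD1_seq u) //= [X in _ + X]big1_seq => [|v /andP[nvu vs]].
  by rewrite gridE // eqxx mul1n addr0 sqr_normcE mulrC.
by rewrite gridE // eq_sym (negbTE nvu) mul0n mulr0.
Qed.

(** The pointwise bound is squared and summed over the grid; Parseval's identity then applies to the
    slice and to g. *)
Lemma parseval_le (g : laurent R[i] r) a (i : 'I_r) (l : int) (x y : R) :
  0 <= x -> 0 <= y ->
  (forall th, nc (lslice g i l (torus_point a th)) * x <=
     y * nc (leval g (torus_point a th))) ->
  (\sum_(u <- msupp g | u 0 i == l)
     (nc (mcoeff u g) * expR (pairing u a)) ^+ 2) * x ^+ 2 <=
  y ^+ 2 * \sum_(u <- msupp g) (nc (mcoeff u g) * expR (pairing u a)) ^+ 2.
Proof.
move=> x0 y0 le_slice.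
pose b u := mcoeff u g * (expR (pairing u a))%:C.
have nb u : nc (b u) = nc (mcoeff u g) * expR (pairing u a).
  by rewrite Normc.normcM normc_real_ge0 ?expR_ge0.
(* K exceeds all differences of coordinates of exponents, so that distinct exponents are distinct
   characters of the grid. *)
pose K := (\sum_(u <- msupp g) \sum_(v <- msupp g)
  \sum_(j < r) absz (u 0 j - v 0 j)%R).+1.
have sepK : {in msupp g &, forall u v, forall j, `|u 0 j - v 0 j| < K%:Z}.
  move=> u v ug vg j; rewrite -abszE ltz_nat ltnS.
  rewrite (big_fsetD1 u) //= (big_fsetD1 v) //= (bigD1 j) //=.
  by rewrite -!addnA leq_addr.
have KR : 0 < (K ^ r)%:R :> R by rewrite ltr0n expn_gt0.
have pars (P : pred 'rV[int]_r) :
    (K ^ r)%:R * \sum_(u <- msupp g | P u) nc (b u) ^+ 2 =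
    \sum_(k : {ffun 'I_r -> 'I_K})
      nc (\sum_(u <- msupp g | P u)
        mcoeff u g * mono u (torus_point a (grid k))) ^+ 2.
  have := @parseval K [seq u <- msupp g | P u] b.
  rewrite big_filter => <-.
  - by apply: eq_bigr => k _; rewrite big_filter; congr (nc _ ^+ 2);
      apply: eq_bigr => u _; rewrite mono_torus_point mulrA.
  - exact/filter_uniq/fset_uniq.
  - by move=> u v; rewrite !mem_filter => /andP[_ ug] /andP[_ vg]; apply: sepK.
under eq_bigr do rewrite -nb; under [X in _ <= _ * X]eq_bigr do rewrite -nb.
have parsT := pars predT; rewrite /= in parsT.
rewrite -(ler_pM2l KR) mulrA pars [leRHS]mulrCA parsT.
rewrite mulr_suml mulr_sumr; apply: ler_sum => k _.
rewrite -!exprMn lerXn2r ?nnegrE ?mulr_ge0 ?normc_ge0 //.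
exact: le_slice.
Qed.

End Parseval.

(** * Supports and Newton polytopes *)

Lemma exists_minimum (T : eqType) (g : T -> int) (x : T) (s : seq T) : x \in s ->
  exists2 y, y \in s & forall z, z \in s -> g y <= g z.
Proof.
elim: s x => // w s IH x _; case: s IH => [|v s] IH.
  by exists w; rewrite ?mem_head // => z; rewrite inE => /eqP ->.
have [y ys ymin] := IH v (mem_head _ _).
have [lewy|ltyw] := leP (g w) (g y).
  exists w; rewrite ?mem_head // => z; rewrite inE => /orP[/eqP -> //|zs].
  exact: le_trans lewy (ymin z zs).
exists y; first by rewrite inE ys orbT.
by move=> z; rewrite inE => /orP[/eqP ->|/ymin //]; exact: ltW.
Qed.

Section Support.
Variables (A : comNzRingType) (r : nat).
Implicit Types (f g : laurent A r) (u v : 'rV[int]_r).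

Lemma msupp_sum I (s : seq I) (P : pred I) (g_ : I -> laurent A r) u :
  u \in msupp (\sum_(k <- s | P k) g_ k) -> exists2 k, P k & u \in msupp (g_ k).
Proof.
elim: s => [|k s IH]; first by rewrite big_nil msupp0.
rewrite big_cons; case: ifP => [Pk /(fsubsetP (msuppD_le _ _))|_ //].
by rewrite in_fsetU => /orP[uk|/IH //]; exists k.
Qed.

Lemma msuppM f g u : u \in msupp (f * g) ->
  exists v w, [/\ v \in msupp f, w \in msupp g & u = v + w].
Proof.
rewrite -[f * g]/(lmul f g) lmul.unlock big_seq => /msupp_sum[v vf].
rewrite big_seq => /msupp_sum[w wg] /(fsubsetP msuppU_le); rewrite inE => /eqP ->.
by exists v, w.
Qed.

Lemma msupp_prod (I : eqType) (s : seq I) (g_ : I -> laurent A r) u :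
  uniq s -> u \in msupp (\prod_(k <- s) g_ k) ->
  exists phi : I -> 'rV[int]_r,
    (forall k, k \in s -> phi k \in msupp (g_ k)) /\ u = \sum_(k <- s) phi k.
Proof.
elim: s u => [|k s IH] u.
  rewrite big_nil => _ /(fsubsetP msuppU_le); rewrite inE => /eqP ->.
  by exists (fun=> 0); rewrite big_nil.
move=> /andP[nks us]; rewrite big_cons => /msuppM[v [w [vk /(IH _ us)]]].
move=> [phi [phiP ->]] ->; exists (fun x => if x == k then v else phi x); split.
  by move=> x; rewrite inE; case: eqP => [-> _ //|_ /phiP].
rewrite big_cons eqxx; congr (_ + _); rewrite !big_seq; apply: eq_bigr => x xs.
by case: eqP xs nks => // -> ->.
Qed.

End Support.

Lemma msupp_ltwist (K : fieldType) (r : nat) (w : 'rV[K]_r) (f : laurent K r) u :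
  u \in msupp (ltwist w f) -> u \in msupp f.
Proof.
rewrite /ltwist big_seq => /msupp_sum[v vf] /(fsubsetP msuppU_le).
by rewrite inE => /eqP ->.
Qed.

Section NewtonPolytope.
Variables (R : realType) (r : nat) (f : laurent R[i] r).
Implicit Types (u v : 'rV[int]_r) (i : 'I_r).

Lemma newton_emb u : u \in msupp f -> newton f (@emb R r u).
Proof.
move=> uf; exists 1%N, (fun=> emb R u), (fun=> 1); split=> //.
- by move=> _; exists u.
- by rewrite big_ord1.
- by rewrite big_ord1 scale1r.
Qed.

(** Boundedness makes the supremum and infimum in [width] genuine bounds. *)
Lemma newton_bound i : exists B : R, forall x, newton f x -> `|x 0 i| <= B.
Proof.
exists (\sum_(u <- msupp f) `|(u 0 i)%:~R|) => _ [m [p [w [pS w0 w1 ->]]]].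
rewrite summxE; apply: le_trans (ler_norm_sum _ _ _) _.
set B := (X in _ <= X).
have -> : B = \sum_j w j * B by rewrite -mulr_suml w1 mul1r.
apply: ler_sum => j _.
rewrite mxE normrM ger0_norm // ler_wpM2l //.
have [u uf <-] := pS j; rewrite mxE /B (big_fsetD1 u) //= lerDl.
by apply: sumr_ge0.
Qed.

Lemma width_ge u v i : u \in msupp f -> v \in msupp f ->
  (u 0 i - v 0 i)%:~R <= width f i.
Proof.
move=> uf vf; have [B HB] := newton_bound i.
rewrite intrB /width; apply: lerB.
  apply: ub_le_sup.
    by exists B => _ [x xf <-]; exact: le_trans (ler_norm _) (HB x xf).
  by exists (emb R u); [exact: newton_emb | rewrite mxE].
apply: ge_inf.
  exists (- B) => _ [x xf <-]; have := HB x xf.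
  by rewrite ler_norml => /andP[].
by exists (emb R v); [exact: newton_emb | rewrite mxE].
Qed.

Lemma max_width_ge0 : 0 <= max_width f.
Proof.
by rewrite /max_width; elim/big_rec: _ => // i x _ x0; rewrite le_max x0 orbT.
Qed.

Lemma width_le_max i : width f i <= max_width f.
Proof. by rewrite /max_width (bigD1 i) //= le_max lexx. Qed.

(** Rounding down is harmless: differences of exponents are integers. *)
Definition nat_width : nat := Num.truncn (max_width f).

Lemma nat_width_le : nat_width%:R <= max_width f.
Proof. by rewrite truncn_le // max_width_ge0. Qed.

Lemma msupp_interval u0 i : u0 \in msupp f -> exists e : int,
  forall u, u \in msupp f -> e <= u 0 i <= e + nat_width%:Z.
Proof.
move=> u0f; have [v vf vmin] := exists_minimum (fun u => u 0 i) u0f.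
exists (v 0 i) => u uf; rewrite vmin //=.
have le_w := le_trans (width_ge i uf vf) (width_le_max i).
have : (absz (u 0 i - v 0 i)%R)%:R <= max_width f.
  apply: le_trans le_w; rewrite -[X in X%:~R](gez0_abs (_ : 0 <= _)) ?subr_ge0 ?vmin //.
rewrite -(@truncn_ge_nat R _ _ max_width_ge0).
by rewrite -/nat_width -lez_nat gez0_abs ?subr_ge0 ?vmin // lerBlDl.
Qed.

Lemma msupp_ftilde n u : u \in msupp (ftilde n f) ->
  exists phi : {ffun 'I_r -> 'I_n} -> 'rV[int]_r,
    (forall k, phi k \in msupp f) /\ u = \sum_k phi k.
Proof.
move=> /(msupp_prod (index_enum_uniq _))[phi [phiP ->]].
exists phi; split=> // k; apply: (@msupp_ltwist _ _ (root_point R k)).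
exact/phiP/mem_index_enum.
Qed.

(** An exponent u of the resultant is a sum of n^r exponents of f, hence n^r times a point of the
    Newton polytope. As n divides u, the quotient u / n is a lattice point of the polytope dilated
    by m = n^(r-1), and m^r = n^(r^2-r). *)
Lemma card_msupp_ftilde n d : (0 < r)%N -> (0 < n)%N ->
  lattice_bound (newton f) d ->
  (forall u i, u \in msupp (ftilde n f) -> (n%:Z %| u 0%R i)%Z) ->
  #|` msupp (ftilde n f)|%:R <= d * n%:R ^+ (r ^ 2 - r).
Proof.
move=> r0 n0 hd dvd_n; set m := (n ^ r.-1)%N.
have m0 : (0 < m)%N by rewrite expn_gt0 n0.
have nR0 : n%:R != 0 :> R by rewrite pnatr_eq0 -lt0n.
pose divn_row (u : 'rV[int]_r) : 'rV[int]_r := \row_j (u 0%R j %/ n%:Z)%Z.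
have divK u : u \in msupp (ftilde n f) -> forall j, u 0 j = divn_row u 0 j * n%:Z.
  by move=> uF j; rewrite mxE divzK // dvd_n.
have img u : u \in msupp (ftilde n f) ->
    lattice_points (newton f) m (divn_row u).
  move=> uF; have [phi [phif defu]] := msupp_ftilde uF.
  exists ((n ^ r)%:R^-1 *: \sum_k emb R (phi k)).
    exists #|{ffun 'I_r -> 'I_n}|, (fun j => emb R (phi (enum_val j))).
    exists (fun=> (n ^ r)%:R^-1); split.
    - by move=> j; exists (phi (enum_val j)) => //; exact: phif.
    - by move=> j; rewrite invr_ge0.
    - rewrite sumr_const card_ord card_ffun !card_ord -[LHS]mulr_natr mulVf //.
      by rewrite natrX expf_neq0.
    - rewrite -scaler_sumr; congr (_ *: _).
      exact: (reindex _ (onW_bij _ (@enum_val_bij _))).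
  apply/rowP => j; rewrite !mxE summxE.
  have := congr1 (fun w : int => w%:~R : R) (divK u uF j).
  rewrite {1}defu summxE rmorph_sum rmorphM /= => eq_sum.
  rewrite (eq_bigr (fun k => (phi k 0 j)%:~R)) => [|k _]; last by rewrite mxE.
  have -> : (n ^ r)%:R = n%:R ^+ r.-1 * n%:R :> R.
    by rewrite -exprSr prednK // natrX.
  have := expf_neq0 r.-1 nR0; rewrite eq_sum /m natrX.
  move: (n%:R ^+ r.-1) => x x0; rewrite -[n%:~R]/(n%:R) mxE; field.
  by rewrite nR0 x0.
(* An infinite set of lattice points would make the bound by the real number d fail. *)
have := hd m m0; rewrite /counting; case: ifPn => [/asboolP finX|_]; last first.
  have m1 : 0 < (m%:R ^+ r)^-1 :> R by rewrite invr_gt0 exprn_gt0 // ltr0n.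
  by rewrite mulyr gtr0_sg // mul1e leye_eq.
rewrite -EFinM lee_fin ler_pdivrMr ?exprn_gt0 ?ltr0n // /m natrX -exprM.
have -> : (r.-1 * r = r ^ 2 - r)%N by case: (r) r0 => // k _; lia.
apply: le_trans; rewrite ler_nat.
have inj : {in msupp (ftilde n f) &, injective divn_row}.
  move=> u v uF vF eq_uv; apply/rowP => j.
  by rewrite (divK u uF) (divK v vF) eq_uv.
have <- : #|` (divn_row @` msupp (ftilde n f))%fset| = #|` msupp (ftilde n f)|.
  exact: card_in_imfset.
apply: fsubset_leq_card; apply/fsubsetP => _ /imfsetP[u /= uF ->].
by rewrite in_fset_set // inE; exact: img.
Qed.

End NewtonPolytope.

(** * Concentration of the coefficients *)

(** Numbers the multiples of n between -n m and n m; elsewhere the value is meaningless. *)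
Definition shift_ord (n m : nat) (x : int) : 'I_(2 * m).+1 :=
  inord (absz (divz x n%:Z + m%:Z)).

Lemma shift_ord_inj n m (x y : int) : (n %| absz x)%N -> (n %| absz y)%N ->
  (absz x <= n * m)%N -> (absz y <= n * m)%N ->
  shift_ord n m x = shift_ord n m y -> x = y.
Proof.
case: n => [|n]; first by rewrite !dvd0n !absz_eq0 => /eqP -> /eqP ->.
move=> /(@dvdzP n.+1%:Z x)[k ->] /(@dvdzP n.+1%:Z y)[l ->].
rewrite !abszM !absz_nat ![(_ * n.+1)%N]mulnC !leq_pmul2l // => le_k le_l.
rewrite /shift_ord !mulzK // => /(congr1 val); rewrite /= !inordK; [|lia|lia].
by move=> eq_kl; congr (_ * _); lia.
Qed.

Section Concentration.
Variables (R : realType) (r n : nat) (D : {fset 'rV[int]_r}).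
Variables (w : 'rV[int]_r -> R) (N : 'rV[int]_r) (kappa q : R).
Hypotheses (n_gt0 : (0 < n)%N) (w_ge0 : forall u, 0 <= w u).
Hypotheses (kappa_ge0 : 0 <= kappa) (q_ge0 : 0 <= q) (q_le1 : q <= 1).
Local Notation S2 := (\sum_(u <- D) w u ^+ 2).
Local Notation X := (Num.sqrt S2).
Hypothesis dvd_D : forall u i, u \in D -> (n %| absz (u 0%R i - N 0%R i)%R)%N.
Hypothesis slice_le : forall i (l : int) (m : nat),
  absz (l - N 0%R i)%R = (n * m)%N ->
  \sum_(u <- D | u 0 i == l) w u ^+ 2 <= (kappa * q ^+ m) ^+ 2 * S2.

Lemma S2_ge0 : 0 <= S2.
Proof. by apply: sumr_ge0 => u _; exact: sqr_ge0. Qed.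

(** In some direction u differs from N by n m with m >= 1, and (w u)^2 is one term of the slice
    through u. *)
Lemma off_peak_le u : u \in D -> u != N -> w u <= kappa * q * X.
Proof.
move=> uD nuN.
have [i nui] : exists i, u 0 i != N 0 i.
  apply/existsP; apply: contraNT nuN => /existsPn eqN.
  by apply/eqP/rowP => j; apply/eqP; have := eqN j; rewrite negbK.
have /dvdnP[m defm] := dvd_D i uD.
have m_gt0 : (0 < m)%N.
  rewrite lt0n; apply: contraNneq nui => m0; move: defm; rewrite m0 mul0n.
  by move/eqP; rewrite absz_eq0 subr_eq0.
rewrite mulnC in defm; have le_slice := slice_le defm.
rewrite -(@ler_pXn2r _ 2) ?nnegrE ?mulr_ge0 ?sqrtr_ge0 //.
rewrite exprMn sqr_sqrtr ?S2_ge0 //.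
apply: (@le_trans _ _ (\sum_(v <- D | v 0 i == u 0 i) w v ^+ 2)).
  rewrite big_mkcond (big_fsetD1 u) //= eqxx lerDl.
  by apply: sumr_ge0 => v _; case: ifP => // _; exact: sqr_ge0.
apply: le_trans le_slice _; rewrite ler_wpM2r ?S2_ge0 //.
rewrite lerXn2r ?nnegrE ?mulr_ge0 ?exprn_ge0 // ler_wpM2l //.
by rewrite -[leRHS]expr1 ler_wiXn2l.
Qed.

Lemma sum_sqr_le (s : seq 'rV[int]_r) (P : pred 'rV[int]_r) :
  \sum_(u <- s | P u) w u ^+ 2 <= (\sum_(u <- s | P u) w u) ^+ 2.
Proof.
elim: s => [|u s IH]; first by rewrite !big_nil expr0n.
rewrite !big_cons; case: ifP => // _; rewrite sqrrD -addrA lerD2l.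
apply: le_trans IH _; rewrite lerDr mulrn_wge0 // mulr_ge0 //.
by apply: sumr_ge0.
Qed.

(** The squares off N add up to at most (7/10)^2 = 49/100 of the total, which leaves at least 51/100
    for N. *)
Lemma peak : 0 < S2 -> \sum_(u <- D | u != N) w u <= 7 / 10 * X ->
  N \in D /\ 7 / 10 * X < w N.
Proof.
move=> S2_gt0 le_sum.
have le_off : \sum_(u <- D | u != N) w u ^+ 2 <= 49 / 100 * S2.
  apply: le_trans (sum_sqr_le _ _) _.
  have -> : 49 / 100 * S2 = (7 / 10 * X) ^+ 2.
    by rewrite exprMn sqr_sqrtr ?S2_ge0 //; congr (_ * _); field.
  rewrite lerXn2r ?nnegrE ?mulr_ge0 ?sqrtr_ge0 ?divr_ge0 //.
  by apply: sumr_ge0.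
have [ND|nND] := boolP (N \in D); last first.
  have eqS : \sum_(u <- D | u != N) w u ^+ 2 = S2.
    rewrite big_seq_cond [RHS]big_seq; apply: eq_bigl => u.
    by case: eqVneq => [->|]; rewrite ?andbT // andbF (negbTE nND).
  by rewrite eqS in le_off; move: S2_gt0 le_off; move: S2 => S; lra.
split=> //; rewrite -(@ltr_pXn2r _ 2) ?nnegrE ?mulr_ge0 ?sqrtr_ge0 ?divr_ge0 //.
rewrite exprMn sqr_sqrtr ?S2_ge0 //.
have eqS : S2 = w N ^+ 2 + \sum_(u <- D | u != N) w u ^+ 2.
  by rewrite (bigD1_seq N) ?fset_uniq.
move: eqS le_off S2_gt0 {le_sum}.
move: S2 (w N ^+ 2) (\sum_(u <- D | u != N) w u ^+ 2) => S x T; lra.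
Qed.

(** The Cauchy-Schwarz inequality against a constant vector, from 2 x y <= x^2 + y^2. *)
Lemma sum_le_sqrt_card (s : seq 'rV[int]_r) :
  (\sum_(u <- s) w u) ^+ 2 <= (size s)%:R * \sum_(u <- s) w u ^+ 2.
Proof.
rewrite expr2 mulr_suml.
apply: (@le_trans _ _ (\sum_(u <- s) \sum_(v <- s) (w u ^+ 2 + w v ^+ 2) / 2)).
  apply: ler_sum => u _; rewrite mulr_sumr; apply: ler_sum => v _.
  by have := sqr_ge0 (w u - w v); rewrite sqrrB; lra.
under eq_bigr do rewrite -mulr_suml big_split /= big_const_seq count_predT iter_addr_0.
rewrite -mulr_suml big_split /= big_const_seq count_predT iter_addr_0.
rewrite sumrMnl mulr_natl; move: (_ *+ _) => y; lra.
Qed.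

(** For l = N_i + n m or N_i - n m, a face of the cube of center N and radius n m. *)
Definition shell i (m : nat) (l : int) : pred 'rV[int]_r :=
  fun u => (u 0 i == l) && [forall j, absz (u 0%R j - N 0%R j)%R <= n * m]%N.

Lemma card_shell i m l : (size [seq u <- D | shell i m l u] <= (2 * m).+1 ^ r.-1)%N.
Proof.
pose phi (u : 'rV[int]_r) : {ffun 'I_r -> 'I_(2 * m).+1} :=
  [ffun j => shift_ord n m (u 0 j - N 0 j)].
pose k0 : 'I_(2 * m).+1 := shift_ord n m (l - N 0 i).
rewrite -(card_ffun_fixed i k0) cardE -(size_map phi); apply: uniq_leq_size.
  rewrite map_inj_in_uniq ?filter_uniq ?fset_uniq // => u v.
  rewrite !mem_filter => /andP[/andP[_ /forallP hu] uD] /andP[/andP[_ /forallP hv] vD].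
  move=> /ffunP eq_phi; apply/rowP => j; have := eq_phi j; rewrite !ffunE.
  by move/(shift_ord_inj (dvd_D j uD) (dvd_D j vD) (hu j) (hv j))/addIr.
move=> _ /mapP[u + ->]; rewrite mem_filter mem_enum => /andP[/andP[/eqP ul _] _].
by rewrite inE ffunE ul.
Qed.

(* 7 / 4 is a rational upper bound of the square root of 3. *)
Lemma sum_shell_le i m l : absz (l - N 0%R i)%R = (n * m)%N ->
  \sum_(u <- D | shell i m l u) w u <= kappa * X * (q * (7 / 4) ^+ r.-1) ^+ m.
Proof.
move=> lm; rewrite -big_filter.
have B0 : 0 <= kappa * X * (q * (7 / 4) ^+ r.-1) ^+ m.
  by rewrite !mulr_ge0 ?sqrtr_ge0 // exprn_ge0 // mulr_ge0 // exprn_ge0 // divr_ge0.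
rewrite -(@ler_pXn2r _ 2) ?nnegrE //; last by apply: sumr_ge0.
apply: le_trans (sum_le_sqrt_card _) _.
(* The number of elements is at most (2m + 1)^(r-1), where 2m + 1 <= 3^m and 3 <= 49/16 =
   (7/4)^2. *)
have le1 : (size [seq u <- D | shell i m l u])%:R <= (49 / 16) ^+ (r.-1 * m) :> R.
  apply: (@le_trans _ _ (3 ^+ (r.-1 * m))); last first.
    by rewrite lerXn2r ?nnegrE ?divr_ge0 //; lra.
  apply: (@le_trans _ _ ((2 * m).+1 ^ r.-1)%:R); first by rewrite ler_nat card_shell.
  rewrite [(r.-1 * m)%N]mulnC exprM natrX lerXn2r ?nnegrE ?exprn_ge0 // -natrX ler_nat.
  elim: m {lm B0} => // m IH; rewrite expnS; lia.
have le2 : \sum_(u <- [seq u <- D | shell i m l u]) w u ^+ 2 <=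
    (kappa * q ^+ m) ^+ 2 * S2.
  apply: le_trans (slice_le lm); rewrite big_filter.
  rewrite [leLHS]big_mkcond [leRHS]big_mkcond; apply: ler_sum => u _.
  by rewrite /shell; case: eqP => //= _; case: ifP => // _; exact: sqr_ge0.
apply: le_trans (ler_pM _ _ le1 le2) _ => //.
  by apply: sumr_ge0 => u _; exact: sqr_ge0.
have -> : (49 / 16) ^+ (r.-1 * m) = (((7 / 4) ^+ r.-1) ^+ m) ^+ 2 :> R.
  by rewrite -[(_ ^+ r.-1) ^+ m]exprM exprAC; congr (_ ^+ _); field.
rewrite -[X in _ * (_ * X)]sqr_sqrtr ?S2_ge0 // [(q * _) ^+ m]exprMn.
move: (_ ^+ m) (q ^+ m) X => y z t.
by rewrite le_eqVlt; apply/orP; left; apply/eqP; ring.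
Qed.

(** Every u other than N lies on one of the 2r faces of a cube around N. Each face of radius n m
    contributes at most kappa X x^m with x = q (7/4)^(r-1), and the geometric series over m >= 1 is
    summed. *)
Lemma off_peak_sum_le : q * (7 / 4) ^+ r.-1 < 1 ->
  (\sum_(u <- D | u != N) w u) * (1 - q * (7 / 4) ^+ r.-1) <=
    2 * r%:R * (q * (7 / 4) ^+ r.-1) * (kappa * X).
Proof.
set x := q * _ => x1.
have x0 : 0 <= x by rewrite mulr_ge0 // exprn_ge0 // divr_ge0.
(* A crude bound of all deviations. Below, the index m stands for the radius n (m + 1), which leaves
   out the center. *)
pose H := (\sum_(u <- D) \sum_j absz (u 0%R j - N 0%R j)%R)%N.
pose sgn (b : bool) (k : nat) : int := if b then k%:Z else - k%:Z.
pose c u (m : 'I_H) (i : 'I_r) (b : bool) :=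
  shell i m.+1 (N 0 i + sgn b (n * m.+1)%N) u.
have cover u : u \in D -> u != N ->
    w u <= \sum_(m < H) \sum_(i < r) \sum_(b : bool) (if c u m i b then w u else 0).
  move=> uD nuN.
  have [i0 nui] : exists i, u 0 i != N 0 i.
    apply/existsP; apply: contraNT nuN => /existsPn eqN.
    by apply/eqP/rowP => j; apply/eqP; have := eqN j; rewrite negbK.
  (* The direction of largest deviation and its sign select the face containing u. *)
  have [i _ imax] := @arg_maxnP _ i0 xpredT (fun j => absz (u 0%R j - N 0%R j)%R) isT.
  have /dvdnP[m defm] := dvd_D i uD.
  have d_gt0 : (0 < absz (u 0%R i - N 0%R i)%R)%N.
    by apply: leq_trans (imax i0 isT); rewrite absz_gt0 subr_eq0.
  case: m defm => [|m] defm; first by move: d_gt0; rewrite defm.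
  have ltmH : (m < H)%N.
    apply: (@leq_trans (absz (u 0%R i - N 0%R i)%R)).
      by rewrite defm leq_pmulr.
    by rewrite /H (big_fsetD1 u) //= (bigD1 i) //= -addnA leq_addr.
  rewrite (bigD1 (Ordinal ltmH)) //= (bigD1 i) //=.
  rewrite (bigD1 (0 <= u 0 i - N 0 i)) //=.
  have -> : c u (Ordinal ltmH) i (0 <= u 0 i - N 0 i).
    rewrite /c /shell /=; apply/andP; split.
      rewrite mulnC -defm /sgn addrC -subr_eq; case: ifP => h.
        by rewrite gez0_abs.
      by rewrite lez0_abs ?opprK // ltW // ltNge h.
    by apply/forallP => j; rewrite mulnC -defm; exact: imax.
  have ge0 (b : bool) : 0 <= (if b then w u else 0) by case: b.
  rewrite -!addrA lerDl; apply: addr_ge0; [|apply: addr_ge0].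
  - by apply: sumr_ge0 => b _; exact: ge0.
  - by do 2![apply: sumr_ge0 => ? _]; exact: ge0.
  - by do 3![apply: sumr_ge0 => ? _]; exact: ge0.
have le_sum : \sum_(u <- D | u != N) w u <=
    \sum_(m < H) 2 * r%:R * (kappa * X) * x ^+ m.+1.
  apply: (@le_trans _ _ (\sum_(u <- D) \sum_(m < H) \sum_(i < r) \sum_(b : bool)
      (if c u m i b then w u else 0))).
    rewrite big_mkcond /= !big_seq; apply: ler_sum => u uD.
    case: ifP => [nuN|_]; first exact: cover.
    by do 3![apply: sumr_ge0 => ? _]; case: ifP.
  rewrite exchange_big; apply: ler_sum => m _ /=.
  rewrite exchange_big.
  apply: (@le_trans _ _ (\sum_(i < r) 2 * (kappa * X * x ^+ m.+1))).
    apply: ler_sum => i _; rewrite exchange_big /=.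
    apply: (@le_trans _ _ (\sum_(b : bool) (kappa * X * x ^+ m.+1))).
      apply: ler_sum => b _; rewrite -big_mkcond; apply: sum_shell_le.
      by rewrite addrC addKr /sgn; case: b; rewrite ?abszN absz_nat.
    by rewrite sumr_const card_bool mulr_natl.
  by rewrite sumr_const card_ord -mulr_natl le_eqVlt; apply/orP; left; apply/eqP; ring.
apply: (@le_trans _ _ ((\sum_(m < H) 2 * r%:R * (kappa * X) * x ^+ m.+1) * (1 - x))).
  by rewrite ler_wpM2r // subr_ge0 ltW.
under eq_bigr do rewrite exprS mulrA.
rewrite -mulr_sumr -mulrA.
have -> : (\sum_(m < H) x ^+ m) * (1 - x) = 1 - x ^+ H.
  by have := subrX1 x H; move: (\sum_(m < H) x ^+ m) (x ^+ H) => s t; lra.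
set Y := kappa * X; have Y0 : 0 <= Y by rewrite mulr_ge0 // sqrtr_ge0.
have -> : 2 * r%:R * x * Y = 2 * r%:R * Y * x * 1 by ring.
by rewrite ler_wpM2l ?mulr_ge0 // gerBl exprn_ge0.
Qed.

End Concentration.

Lemma dvdn_abszB n (x y : int) : (n %| absz x)%N -> (n %| absz y)%N ->
  (n %| absz (x - y)%R)%N.
Proof.
move=> /(@dvdzP n%:Z x)[k ->] /(@dvdzP n%:Z y)[l ->].
by rewrite -mulrBl abszM dvdn_mull.
Qed.

(** * Lopsided lists indexed by exponents *)

Section Lists.
Variables (R : realType) (T : eqType) (D : seq T) (w : T -> R) (x : T).
Hypotheses (uD : uniq D) (xD : x \in D).

Lemma lopsided_map : \sum_(u <- D | u != x) w u < w x ->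
  lopsided [seq w u | u <- D].
Proof.
have ltx : (index x D < size [seq w u | u <- D])%N by rewrite size_map index_mem.
move=> lt_sum; exists (Ordinal ltx) => /=.
rewrite (nth_map x) ?index_mem // nth_index //.
apply: le_lt_trans lt_sum; rewrite le_eqVlt; apply/orP; left; apply/eqP.
transitivity (\sum_(0 <= j < size D | j != index x D) [seq w u | u <- D]`_j).
  by rewrite -(size_map w D) big_mkord.
rewrite [RHS](big_nth x) [LHS]big_nat_cond [RHS]big_nat_cond.
apply: eq_big => [j|j]; last first.
  by case/andP=> /= ltj _; rewrite (nth_map x).
case: (ltnP j (size D)) => [ltj|_]; last by rewrite andbF.
by rewrite -{3}(nth_index x xD) nth_uniq // index_mem.
Qed.

Lemma dsuperlopsided_map d : (forall u, u \in D -> u != x -> d * w u < w x) ->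
  dsuperlopsided d [seq w u | u <- D].
Proof.
have ltx : (index x D < size [seq w u | u <- D])%N by rewrite size_map index_mem.
move=> lt_w; exists (Ordinal ltx) => j nj /=.
have ltj : (j < size D)%N by rewrite -(size_map w).
rewrite !(nth_map x) ?index_mem // nth_index //; apply: lt_w; first exact: mem_nth.
by rewrite -{2}(nth_index x xD) nth_uniq // index_mem.
Qed.

End Lists.

(** * Decay of the slices of the cyclic resultant *)

Section Assembly.
Variables (R : realType) (r : nat) (f : laurent R[i] r) (a : 'rV[R]_r) (eps : R).
Variable n : nat.
Hypotheses (eps_gt0 : 0 < eps) (n_gt0 : (0 < n)%N).
Hypothesis clear_a : forall z, torus z -> leval f z = 0 ->
  eps <= eucl_dist a (Log z).
Local Notation nc := (@Normc.normc R).
Local Notation F := (ftilde n f).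
Local Notation delta := (expR (- (n%:R * eps))).

Definition weight u : R := nc (mcoeff u F) * expR (pairing u a).
Local Notation S2 := (\sum_(u <- msupp F) weight u ^+ 2).

Lemma norms_atE : norms_at F a = [seq weight u | u <- msupp F].
Proof.
apply: eq_map => u; rewrite /weight Normc.normcM -(normc_mono a 0).
congr (_ * nc (mono _ _)).
by apply/rowP => j; rewrite !mxE cis0 mulr1.
Qed.

Lemma weight_ge0 u : 0 <= weight u.
Proof. by rewrite mulr_ge0 ?normc_ge0 ?expR_ge0. Qed.

Lemma weight_gt0 u : u \in msupp F -> 0 < weight u.
Proof. by move=> uF; rewrite mulr_gt0 ?expR_gt0 // normc_gt0 mcoeff_neq0. Qed.

Lemma msupp_neq0 : exists u, u \in msupp f.
Proof.
have fa := fiber_torus_point a 0.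
case: (fset_0Vmem (msupp f)) => [supp0|[u uf]]; last by exists u.
have := fiber_leval_neq0 eps_gt0 clear_a fa.
by rewrite /leval supp0 big_seq_fset0 eqxx.
Qed.

Lemma ftilde_neq0 : exists u, u \in msupp F.
Proof.
have fa := fiber_torus_point a 0.
case: (fset_0Vmem (msupp F)) => [supp0|[u uF]]; last by exists u.
suff : leval F (torus_point a 0) != 0 by rewrite /leval supp0 big_seq_fset0 eqxx.
have [ta _] := fa; rewrite leval_ftilde //; apply/prodf_neq0 => k _.
apply: (fiber_leval_neq0 eps_gt0 clear_a); apply: fiberP => j.
by rewrite mxE Normc.normcM normc_cis mul1r (fiber_normc _ fa).
Qed.

Lemma S2_gt0 : 0 < S2.
Proof.
have [u uF] := ftilde_neq0.
rewrite (big_fsetD1 u) //= ltr_pwDl ?exprn_gt0 ?weight_gt0 //.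
by apply: sumr_ge0 => v _; exact: sqr_ge0.
Qed.

Lemma slice_eq0 i l : (forall th, lslice F i l (torus_point a th) = 0) ->
  \sum_(u <- msupp F | u 0 i == l) weight u ^+ 2 = 0.
Proof.
move=> sl0; have := @parseval_le R r F a i l 1 0 ler01 (lexx 0).
rewrite expr1n mulr1 expr0n mul0r => /(_ _) le0; apply: le_anti.
rewrite sumr_ge0 ?andbT; last by move=> u _; exact: sqr_ge0.
by apply: le0 => th; rewrite sl0 Normc.normc0 !mul0r.
Qed.

(** A slice that vanishes on the whole fiber has no monomial, by Parseval's identity, and
    [ftilde_slices] leaves only slices at multiples of n. *)
Lemma dvd_msupp u i : u \in msupp F -> (n %| absz (u 0%R i))%N.
Proof.
move=> uF; have [u0 u0f] := msupp_neq0; have [e width_i] := msupp_interval i u0f.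
apply: contraTT uF => ndvd; apply/negP => uF.
have := @slice_eq0 i (u 0 i); rewrite big_mkcond (big_fsetD1 u) //= eqxx.
have : 0 <= \sum_(v <- (msupp F `\ u)%fset)
    (if v 0 i == u 0 i then weight v ^+ 2 else 0).
  by apply: sumr_ge0 => v _; case: ifP => // _; exact: sqr_ge0.
set Y := \sum_(v <- _) _ => Y0 eq0.
have : weight u ^+ 2 + Y = 0.
  apply: eq0 => th.
  have [lam _ [bs [_ _ _ _ sl0]]] :=
    ftilde_slices eps_gt0 n_gt0 clear_a width_i (fiber_torus_point a th).
  apply: sl0 => j; apply: contraNneq ndvd => ->.
  by rewrite !PoszM mulrCA -mulrDr abszM dvdn_mulr.
by apply/eqP; rewrite gt_eqF // ltr_pwDl // exprn_gt0 // weight_gt0.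
Qed.

(** Each direction yields its own dominant index, hence one coordinate of N; these are collected
    into one exponent. *)
Lemma slices_decay q : 0 < q -> q < 1 / 4 ->
  (nat_width f * n ^ r.-1)%:R * delta <= q ->
  exists N : 'rV[int]_r,
    (forall u i, u \in msupp F -> (n %| absz (u 0%R i - N 0%R i)%R)%N) /\
    (forall i l m, absz (l - N 0%R i)%R = (n * m)%N ->
      \sum_(u <- msupp F | u 0 i == l) weight u ^+ 2 <=
        (3 / (1 - q) * q ^+ m) ^+ 2 * S2).
Proof.
move=> q0 q4 le_q; have [u0 u0f] := msupp_neq0.
have q1 := lt_quarter_lt1 q4.
suff /fin_all_exists[N HN] : forall i : 'I_r, exists Ni : int, (n %| absz Ni)%N /\
    (forall l m, absz (l - Ni)%R = (n * m)%N ->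
      \sum_(u <- msupp F | u 0 i == l) weight u ^+ 2 <=
        (3 / (1 - q) * q ^+ m) ^+ 2 * S2).
  exists (\row_i N i); split=> [u i uF|i l m].
    have [dvdN _] := HN i; have := dvd_msupp i uF.
    by rewrite mxE => dvdu; exact: dvdn_abszB.
  by rewrite mxE; have [_] := HN i; apply.
move=> i; have [e width_i] := msupp_interval i u0f.
have [s le_s dom] :=
  dominant_index eps_gt0 n_gt0 clear_a width_i q0 q4 le_q.
exists (e * (n * n ^ r.-1)%:Z + (n * s)%:Z); split=> [|l m lm].
  by rewrite !PoszM mulrCA -mulrDr abszM dvdn_mulr.
have q10 : 0 < 1 - q by rewrite subr_gt0.
have B0 : 0 <= 3 * q ^+ m by rewrite mulr_ge0 // exprn_ge0 // ltW.
have -> : 3 / (1 - q) * q ^+ m = (3 * q ^+ m) / (1 - q) by rewrite mulrAC.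
rewrite expr_div_n mulrAC ler_pdivlMr ?exprn_gt0 //.
(* Used with x = 1 - q and y = 3 q^m, as in the first clause of [dominant_at]. *)
apply: parseval_le => //; first exact: ltW.
move=> th; have [bound _ sl0] := dom th.
(* If the index of l would be negative, the slice is zero. *)
have [[j lj]|nl] := pselect (exists j : nat, l = e * (n * n ^ r.-1)%:Z + (n * j)%:Z).
  have <- : ndist j s = m.
    apply/eqP; rewrite -(eqn_pmul2l n_gt0) -lm lj.
    rewrite opprD addrACA subrr add0r !PoszM -mulrBr abszM absz_nat.
    by rewrite eqn_pmul2l //; apply/eqP; rewrite /ndist; lia.
  by rewrite lj; exact: bound.
rewrite sl0 => [|j]; last by apply/eqP => lj; apply: nl; exists j.
by rewrite Normc.normc0 mul0r mulr_ge0 // normc_ge0.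
Qed.

End Assembly.

(** * Numerical constants *)

Section Constants.
Variable R : realType.

Lemma expR_log_bound (n k : nat) (x y : R) : (0 < n)%N -> 0 < x ->
  k%:R * ln n%:R + ln x <= y -> n%:R ^+ k * x * expR (- y) <= 1.
Proof.
move=> n0 x0 le_y.
have -> : n%:R ^+ k * x = expR (k%:R * ln n%:R + ln x).
  by rewrite expRD expRM_natl !lnK // posrE ltr0n.
by rewrite expRN ler_pdivrMr ?expR_gt0 // mul1r ler_expR.
Qed.

(** Below 6 the values are checked one by one. From k = 6 on the left side does not increase,
    because 7 (k + 2) <= 8 (k + 1), and it stays below 4, the value of the right side at 6. *)
Lemma geometric_bound (k : nat) :
  k.+1%:R * (7 / 8) ^+ k <= 2 / 5 * (k%:R + 4) :> R.
Proof.
have [|le6k] := ltnP k 6.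
  by case: k => [|[|[|[|[|[|//]]]]]] _; lra.
suff : k.+1%:R * (7 / 8) ^+ k <= 4 :> R.
  have : 6%:R <= k%:R :> R by rewrite ler_nat.
  lra.
rewrite -(subnK le6k); elim: (k - 6)%N => [|m IH]; first by lra.
apply: le_trans IH; rewrite addSn exprSr mulrA.
have : 0 <= (7 / 8 : R) ^+ (m + 6) by rewrite exprn_ge0 // divr_ge0.
rewrite -[(m + 6).+2]addn2 -[(m + 6).+1]addn1 !natrD.
have : 0 <= m%:R :> R by [].
move: (m%:R : R) ((7 / 8 : R) ^+ _) => y z; nra.
Qed.

(** The constants give (1/5) (16/5) / (15/16) = 256/375 < 7/10. *)
Lemma off_peak_const (X s k x y : R) : 0 <= X -> 0 <= s -> 0 <= k ->
  k <= 16 / 5 -> y <= 1 / 5 -> x <= 1 / 16 -> s * (1 - x) <= y * (k * X) ->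
  s <= 7 / 10 * X.
Proof.
move=> X0 s0 k0 k_le y_le x_le le_s.
have le1 : k * X <= 16 / 5 * X by rewrite ler_wpM2r.
have kX0 : 0 <= k * X by rewrite mulr_ge0.
have le2 : y * (k * X) <= 1 / 5 * (k * X) by rewrite ler_wpM2r.
have le3 : s * (15 / 16) <= s * (1 - x) by rewrite ler_wpM2l //; lra.
lra.
Qed.

End Constants.

Lemma predn_addn_sqr (r : nat) : (0 < r)%N -> (r ^ 2 = (r.-1 + (r ^ 2 - r)).+1)%N.
Proof. by case: r => // k _; lia. Qed.

(** * Lopsidedness and superlopsidedness *)

Section Conclusion.
Variables (R : realType) (r : nat) (f : laurent R[i] r) (a : 'rV[R]_r) (eps : R).
Variable n : nat.
Hypotheses (eps_gt0 : 0 < eps) (n_gt0 : (0 < n)%N) (r_gt0 : (0 < r)%N).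
Hypothesis clear_a : forall z, torus z -> leval f z = 0 ->
  eps <= eucl_dist a (Log z).
Local Notation F := (ftilde n f).
Local Notation delta := (expR (- (n%:R * eps))).
Local Notation wt := (weight f a n).

(** For width 0 the logarithm in the hypothesis of the theorem is minus infinity and gives no
    information, but then [nat_width] is 0 and the bound is trivial. *)
Lemma width_delta_le (q : R) : 0 < q ->
  (0 < max_width f -> max_width f * n%:R ^+ r.-1 * delta <= q) ->
  (nat_width f * n ^ r.-1)%:R * delta <= q.
Proof.
move=> q0 le_q; have le_w := nat_width_le f.
have [w_gt0|] := ltP 0 (max_width f).
  apply: le_trans (le_q w_gt0); rewrite ler_wpM2r ?expR_ge0 //.
  by rewrite natrM natrX ler_wpM2r // exprn_ge0.
move=> w_le0; have /eqP -> : nat_width f == 0%N.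
  by rewrite -leqn0 -(ler_nat R) (le_trans le_w).
by rewrite mul0n mul0r ltW.
Qed.

Lemma ftilde_lopsided :
  (((r%:R - 1) * ln n%:R)%:E + lne ((r%:R + 3) * 2 ^+ r.+1 * max_width f)%:E
     <= (n%:R * eps)%:E)%E ->
  lopsided (norms_at F a).
Proof.
move=> hyp; pose B : R := (r%:R + 3) * 2 ^+ r.+1.
have B_gt0 : 0 < B by rewrite mulr_gt0 ?exprn_gt0 // ltr_wpDl.
(* With this q the hypothesis reads c n^(r-1) delta <= q. *)
pose q := B^-1; have q_gt0 : 0 < q by rewrite invr_gt0.
have [k defr] : exists k, r = k.+1 by exists r.-1; rewrite prednK.
have q_le : q <= 1 / 16.
  rewrite mul1r lef_pV2 ?posrE //.
  have : 4 <= 2 ^+ r.+1 :> R.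
    rewrite defr !exprS; have : 1 <= 2 ^+ k :> R by rewrite exprn_ege1 // ler1n.
    by move: (2 ^+ k) => y; lra.
  have : 1 <= r%:R :> R by rewrite ler1n.
  rewrite /B; move: (2 ^+ _ : R) (r%:R : R) => y z; nra.
have q_lt4 : q < 1 / 4 by apply: le_lt_trans q_le _; lra.
have le_q : (nat_width f * n ^ r.-1)%:R * delta <= q.
  apply: width_delta_le => // w_gt0; rewrite -[q]mul1r ler_pdivlMr //.
  have Bw_gt0 : 0 < B * max_width f by rewrite mulr_gt0.
  move: hyp; rewrite lne_EFin // -EFinD lee_fin => hyp.
  have := @expR_log_bound R n r.-1 _ _ n_gt0 Bw_gt0.
  have -> : r.-1%:R = r%:R - 1 :> R by rewrite defr -natr1 addrK.
  move=> /(_ _ hyp); apply: le_trans.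
  by rewrite le_eqVlt; apply/orP; left; apply/eqP; ring.
have [N [dvdN sliceN]] :=
  slices_decay eps_gt0 n_gt0 clear_a q_gt0 q_lt4 le_q.
have q_le1 : q <= 1 by apply: ltW; exact: lt_quarter_lt1.
have kappa0 : 0 <= 3 / (1 - q) by rewrite divr_ge0 // subr_ge0.
have kappa_le : 3 / (1 - q) <= 16 / 5.
  by rewrite ler_pdivrMr; [lra | rewrite subr_gt0; exact: lt_quarter_lt1].
pose x := q * (7 / 4) ^+ r.-1.
(* The factor 2^(r-1) of B absorbs (7/4)^(r-1), and k + 4 = r + 3. *)
have defx : x = (7 / 8) ^+ k / (4 * (k%:R + 4)).
  rewrite /x; have -> : (7 / 4 : R) ^+ r.-1 = (7 / 8) ^+ k * 2 ^+ k.
    by rewrite defr -exprMn; congr (_ ^+ _); field.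
  have y0 : (2 : R) ^+ k != 0 by rewrite expf_neq0 // pnatr_eq0.
  have z0 : k%:R + 4 != 0 :> R by rewrite gt_eqF // ltr_wpDl.
  rewrite /q /B defr -natr1 !exprS (_ : k%:R + 1 + 3 = k%:R + 4); last by ring.
  move: (2 ^+ k : R) ((7 / 8 : R) ^+ k) (k%:R + 4 : R) y0 z0 => y v z y0 z0.
  by field; rewrite y0 z0.
have k4 : 0 < k%:R + 4 :> R by rewrite ltr_wpDl.
have e78 : 0 <= (7 / 8 : R) ^+ k <= 1.
  by rewrite exprn_ge0 ?exprn_ile1 ?divr_ge0 //; lra.
have x0 : 0 <= x by rewrite defx divr_ge0 ?mulr_ge0 ?ltW //; case/andP: e78.
have x_le : x <= 1 / 16.
  rewrite defx ler_pdivrMr ?mulr_gt0 //.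
  by have : 0 <= k%:R :> R by []; move: e78 => /andP[_]; lra.
have rx_le : 2 * r%:R * x <= 1 / 5.
  have := geometric_bound R k; rewrite defx defr mulrA ler_pdivrMr ?mulr_gt0 //.
  by move: (_ ^+ _) k.+1%:R k%:R => u v w; lra.
rewrite norms_atE.
have wt0 := weight_ge0 f a n.
have x_lt1 : x < 1 by apply: le_lt_trans x_le _; lra.
have := off_peak_sum_le n_gt0 wt0 kappa0 (ltW q_gt0) q_le1 dvdN sliceN x_lt1.
rewrite -/x => le_sum.
have le_off : \sum_(u <- msupp F | u != N) wt u <=
    7 / 10 * Num.sqrt (\sum_(u <- msupp F) wt u ^+ 2).
  have s0 : 0 <= \sum_(u <- msupp F | u != N) wt u by apply: sumr_ge0.
  have X0 := sqrtr_ge0 (\sum_(u <- msupp F) wt u ^+ 2).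
  exact: (off_peak_const X0 s0 kappa0 kappa_le rx_le x_le le_sum).
have [NF lt_N] := peak wt0 (S2_gt0 n eps_gt0 clear_a) le_off.
by apply: lopsided_map NF _; [exact: fset_uniq | exact: le_lt_trans lt_N].
Qed.

Lemma ftilde_superlopsided d : lattice_bound (newton f) d ->
  (((r%:R ^+ 2 - 1) * ln n%:R)%:E + lne (16 / 3 * max_width f * d)%:E
     <= (n%:R * eps)%:E)%E ->
  superlopsided (norms_at F a) /\
  dsuperlopsided (d * n%:R ^+ (r ^ 2 - r)) (norms_at F a).
Proof.
move=> hd hyp; set D := d * _.
have cardF : #|` msupp F|%:R <= D.
  apply: card_msupp_ftilde => // u i uF.
  exact: (dvd_msupp eps_gt0 n_gt0 clear_a).
have card_gt0 : (0 < #|` msupp F|)%N.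
  have [u uF] := ftilde_neq0 n eps_gt0 clear_a.
  by rewrite cardfs_gt0; apply/fset0Pn; exists u.
have D1 : 1 <= D by apply: le_trans cardF; rewrite ler1n.
have D0 : 0 < D by apply: lt_le_trans D1.
have np0 : 0 < n%:R ^+ (r ^ 2 - r) :> R by rewrite exprn_gt0 // ltr0n.
have d0 : 0 < d by rewrite -(pmulr_lgt0 _ np0).
(* The hypothesis says (16/3) c d n^(r^2-1) delta <= 1, which is c n^(r-1) delta <= q since r^2 - 1
   = (r - 1) + (r^2 - r). *)
pose q := 3 / (16 * D).
have D16 : 0 < 16 * D by rewrite mulr_gt0.
have q_gt0 : 0 < q by rewrite divr_gt0.
have qD : q * D = 3 / 16 by rewrite /q; field; rewrite gt_eqF.
have q_le : q <= 3 / 16 by rewrite -qD ler_peMr // ltW.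
have q_lt4 : q < 1 / 4 by apply: le_lt_trans q_le _; lra.
have le_q : (nat_width f * n ^ r.-1)%:R * delta <= q.
  apply: width_delta_le => // w_gt0.
  have x_gt0 : 0 < 16 / 3 * max_width f * d by rewrite !mulr_gt0 // divr_gt0.
  move: hyp; rewrite lne_EFin // -EFinD lee_fin => hyp.
  have := @expR_log_bound R n (r.-1 + (r ^ 2 - r)) _ (n%:R * eps) n_gt0 x_gt0.
  have -> : (r.-1 + (r ^ 2 - r))%:R = r%:R ^+ 2 - 1 :> R.
    apply/eqP; rewrite eq_sym subr_eq natr1 -natrX eqr_nat; apply/eqP.
    exact: predn_addn_sqr.
  move=> /(_ hyp); rewrite exprD /q ler_pdivlMr // => le1.
  have -> : max_width f * n%:R ^+ r.-1 * delta * (16 * D) =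
      3 * (n%:R ^+ r.-1 * n%:R ^+ (r ^ 2 - r) * (16 / 3 * max_width f * d) * delta).
    by rewrite /D; field.
  by rewrite -[leRHS]mulr1 ler_wpM2l.
have [N [dvdN sliceN]] :=
  slices_decay eps_gt0 n_gt0 clear_a q_gt0 q_lt4 le_q.
have q_le1 : q <= 1 by apply: ltW; exact: lt_quarter_lt1.
have kappa0 : 0 <= 3 / (1 - q) by rewrite divr_ge0 // subr_ge0.
have kappa_le : 3 / (1 - q) <= 48 / 13.
  by rewrite ler_pdivrMr; [lra | rewrite subr_gt0; exact: lt_quarter_lt1].
have wt0 := weight_ge0 f a n.
set X := Num.sqrt (\sum_(u <- msupp F) wt u ^+ 2).
have X0 : 0 <= X := sqrtr_ge0 _.
(* Here q D = 3/16, and (48/13) (3/16) = 9/13 < 7/10. *)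
have Dk : D * (3 / (1 - q) * q * X) <= 7 / 10 * X.
  have -> : D * (3 / (1 - q) * q * X) = 3 / (1 - q) * (q * D) * X by ring.
  by rewrite qD ler_wpM2r //; lra.
have offN u : u \in msupp F -> u != N -> wt u <= 3 / (1 - q) * q * X.
  by move=> uF nuN; exact: (off_peak_le wt0 kappa0 (ltW q_gt0) q_le1 dvdN sliceN).
have kqX0 : 0 <= 3 / (1 - q) * q * X.
  exact: mulr_ge0 (mulr_ge0 kappa0 (ltW q_gt0)) X0.
(* There are at most D terms, each bounded by [offN]. *)
have le_off : \sum_(u <- msupp F | u != N) wt u <= 7 / 10 * X.
  apply: le_trans Dk.
  apply: (@le_trans _ _ (\sum_(u <- msupp F) (3 / (1 - q) * q * X))).
    rewrite big_mkcond !big_seq; apply: ler_sum => u uF.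
    by case: ifP => // nuN; exact: offN.
  rewrite big_const_seq count_predT iter_addr_0 -[leLHS]mulr_natl.
  by rewrite ler_wpM2r.
have [NF lt_N] := peak wt0 (S2_gt0 n eps_gt0 clear_a) le_off.
have dom u : u \in msupp F -> u != N -> D * wt u < wt N.
  move=> uF nuN; apply: le_lt_trans lt_N; apply: le_trans Dk.
  by rewrite ler_wpM2l ?offN // ltW.
rewrite norms_atE; split; last first.
  exact: (dsuperlopsided_map (fset_uniq _) NF dom).
(* The length of the list is at most D, so that the factor D yields plain superlopsidedness as
   well. *)
apply: (dsuperlopsided_map (fset_uniq _) NF) => u uF nuN.
apply: le_lt_trans (dom u uF nuN); rewrite ler_wpM2r // size_map.
by apply: le_trans cardF; rewrite ler_nat leq_pred.
Qed.

End Conclusion.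

Theorem theorem1 (R : realType) (r : nat) (hr : (1 <= r)%N)
    (f : laurent R[i] r) (eps : R) (heps : 0 < eps)
    (a : 'rV[R]_r) (ha : ~ amoeba f a)
    (hdist : (eps%:E <= dist_to (amoeba f) a)%E)
    (d : R) (hd : lattice_bound (newton f) d)
    (n : nat) (hn : (0 < n)%N) :
  ((((r%:R - 1) * ln n%:R)%:E
      + lne ((r%:R + 3) * 2 ^+ r.+1 * max_width f)%:E
      <= (n%:R * eps)%:E)%E ->
    lopsided (norms_at (ftilde n f) a))
  /\
  ((((r%:R ^+ 2 - 1) * ln n%:R)%:E + lne (16 / 3 * max_width f * d)%:E
      <= (n%:R * eps)%:E)%E ->
    superlopsided (norms_at (ftilde n f) a) /\
    dsuperlopsided (d * n%:R ^+ (r ^ 2 - r)) (norms_at (ftilde n f) a)).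
Proof.
have clear_a z : torus z -> leval f z = 0 -> eps <= eucl_dist a (Log z).
  move=> tz fz0; rewrite -lee_fin; apply: le_trans hdist _.
  by apply: ereal_inf_lbound; exists (Log z) => //; exists z.
split; first exact: (ftilde_lopsided heps hn hr clear_a).
exact: (ftilde_superlopsided heps hn hr clear_a hd).
Qed.
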